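(* In the setting of the context, let $M_{\mathrm{PD}}\in\mathbb{R}^{(n+m)\times(n+m)}$ be the matrix defined there (depending on $\theta$), let $M_{\mathrm{PD}}^k$ denote its $k$-th power, and let $\rho(\cdot)$ denote the spectral radius. The following holds. (i) If $\theta=1$, then $M_{\mathrm{PD}}$ is convergent to $M_{\mathrm{PD}}^\infty$, i.e. $$M_{\mathrm{PD}}^\infty:=\lim_{k\to\infty}M_{\mathrm{PD}}^k$$ exists, and it is the projection operator onto the set of fixed points of $M_{\mathrm{PD}}$. Moreover, $$\forall k\in\mathbb{N},\quad M_{\mathrm{PD}}^k-M_{\mathrm{PD}}^\infty=(M_{\mathrm{PD}}-M_{\mathrm{PD}}^\infty)^k\qquad\text{and}\qquad \rho(M_{\mathrm{PD}}-M_{\mathrm{PD}}^\infty)<1.$$ Given any $\rho\in\,]\rho(M_{\mathrm{PD}}-M_{\mathrm{PD}}^\infty),1[$, there is $K$ large enough such that for all $k\ge K$, $\|M_{\mathrm{PD}}^k-M_{\mathrm{PD}}^\infty\|=O(\rho^k)$. (ii) Suppose $F=G^*=0$ and $R,J^*$ are locally polyhedral around $(x^\star,v^\star)$. Then given any $\theta\in\,]0,1]$, $M_{\mathrm{PD}}$ is convergent with $$M_{\mathrm{PD}}^\infty=\begin{bmatrix}Y&\\&X\end{bmatrix}\begin{bmatrix}0_l&&&\\&\mathrm{Id}_{n-l}&&\\&&0_l&\\&&&\mathrm{Id}_{m-l}\end{bmatrix}\begin{bmatrix}Y^*&\\&X^*\end{bmatrix},$$ where $\overline L=X\Sigma_{\overline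 L}Y^*$ is the singular value decomposition of $\overline L$ and $l=\mathrm{rank}(\overline L)$. Moreover, all the eigenvalues of $M_{\mathrm{PD}}-M_{\mathrm{PD}}^\infty$ are complex, with the spectral radius $$\rho(M_{\mathrm{PD}}-M_{\mathrm{PD}}^\infty)=\sqrt{1-\theta\gamma_R\gamma_J\sigma_{\min}^2}<1,$$ where $\sigma_{\min}$ is the smallest non-zero singular value of $\overline L$.
   Context: **Setting.** $\mathbb{N}$ is the set of non-negative integers. $\Gamma_0$ is the set of proper convex lower semicontinuous functions; $J^*$ is the Legendre–Fenchel conjugate of $J$; $\mathrm{ri}$ is relative interior; $\mathrm{P}_T$ is orthogonal projection onto $T$. $R,F\in\Gamma_0(\mathbb{R}^n)$ with $\nabla F$ $(1/\beta_F)$-Lipschitz, $\beta_F>0$; $J,G\in\Gamma_0(\mathbb{R}^m)$ with $G$ $\beta_G$-strongly convex, $\beta_G>0$; $L:\mathbb{R}^n\to\mathbb{R}^m$ linear; $\gamma_R,\gamma_J>0$ satisfy $$2\min\{\beta_F,\beta_G\}\min\{1/\gamma_J,1/\gamma_R\}\big(1-\sqrt{\gamma_J\gamma_R\|L\|^2}\big)>1$$ (which implies $\gamma_J\gamma_R\|L\|^2<1$; the latter is the condition needed when $F=G^*=0$). $(x^\star,v^\star)$ is a Kuhn–Tucker pair: $0\in\partial R(x^\star)+L^*v^\star+\nabla F(x^\star)$ and $0\in\partial J^*(v^\star)-Lx^\star+\nabla G^*(v^\star)$. $R\in\mathrm{PSF}_{x^\star}(\mathcal{M}^R_{x^\star})$,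 $J^*\in\mathrm{PSF}_{v^\star}(\mathcal{M}^{J^*}_{v^\star})$; $F$ is $C^2$ near $x^\star$ and $G^*$ is $C^2$ near $v^\star$. Either the non-degeneracy condition $-L^*v^\star-\nabla F(x^\star)\in\mathrm{ri}(\partial R(x^\star))$, $Lx^\star-\nabla G^*(v^\star)\in\mathrm{ri}(\partial J^*(v^\star))$ holds, or $\mathcal{M}^R_{x^\star}$ and $\mathcal{M}^{J^*}_{v^\star}$ are affine subspaces. Finally $\dim(T^{J^*}_{v^\star})\ge\dim(T^R_{x^\star})$. **Partial smoothness.** $\mathrm{par}(C)$ is the linear subspace parallel to the affine hull of a convex set $C$; $T^R_x:=\mathrm{par}(\partial R(x))^\perp$. $R\in\mathrm{PSF}_x(\mathcal{M})$, where $R\in\Gamma_0$, $\partial R(x)\ne\emptyset$ and $x\in\mathcal{M}$, means: (1) $\mathcal{M}$ is a $C^2$-smooth embedded submanifold around $x$ and $R|_{\mathcal{M}}$ is $C^2$ around $x$; (2) the tangent space of $\mathcal{M}$ at $x$ equals $T^R_x$; (3) the set-valued map $\partial R$ is continuous at $x$ relative to $\mathcal{M}$. A function is locally polyhedral around a point if it coincides near that point with a polyhedral function (epigraph a polyhedron); ''$R,J^*$ locally polyhedral around $(x^\star,v^\star)$'' means $R$ is so around $x^\star$ and $J^*$ around $v^\star$. **Riemannian Hessian.** For $f$ that is $C^2$ along $\mathcal{M}$ near $x\in\mathcal{M}$, $\nabla^2_{\mathcal{M}}f(x)$ is the symmetric linear map on the tangent space $\mathcal{T}$ of $\mathcal{M}$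 at $x$ with $\langle\nabla^2_{\mathcal{M}}f(x)h,h\rangle=\frac{d^2}{dt^2}f(\mathrm{P}_{\mathcal{M}}(x+th))|_{t=0}$, $h\in\mathcal{T}$, $\mathrm{P}_{\mathcal{M}}$ being the projection onto $\mathcal{M}$. **The matrix.** Let $T^R=T^R_{x^\star}$, $T^{J^*}=T^{J^*}_{v^\star}$, $\overline R(x)=R(x)+\langle x,L^*v^\star+\nabla F(x^\star)\rangle$, $\overline{J^*}(y)=J^*(y)-\langle y,Lx^\star-\nabla G^*(v^\star)\rangle$, $H_{\overline R}=\gamma_R\mathrm{P}_{T^R}\nabla^2_{\mathcal{M}^R_{x^\star}}\overline R(x^\star)\mathrm{P}_{T^R}$, $H_{\overline{J^*}}=\gamma_J\mathrm{P}_{T^{J^*}}\nabla^2_{\mathcal{M}^{J^*}_{v^\star}}\overline{J^*}(v^\star)\mathrm{P}_{T^{J^*}}$ (symmetric positive semidefinite in this setting), $W_{\overline R}=(\mathrm{Id}_n+H_{\overline R})^{-1}$, $W_{\overline{J^*}}=(\mathrm{Id}_m+H_{\overline{J^*}})^{-1}$, $H_F=\mathrm{P}_{T^R}\nabla^2F(x^\star)\mathrm{P}_{T^R}$, $H_{G^*}=\mathrm{P}_{T^{J^*}}\nabla^2G^*(v^\star)\mathrm{P}_{T^{J^*}}$, $\overline H_F=\mathrm{Id}_n-\gamma_RH_F$, $\overline H_{G^*}=\mathrm{Id}_m-\gamma_JH_{G^*}$, $\overline L=\mathrm{P}_{T^{J^*}}L\,\mathrm{P}_{T^R}$. Then $$M_{\mathrm{PD}}=\begin{bmatrix}W_{\overline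 R}\overline H_F&-\gamma_RW_{\overline R}\overline L^*\\ \gamma_J(1+\theta)W_{\overline{J^*}}\overline LW_{\overline R}\overline H_F-\theta\gamma_JW_{\overline{J^*}}\overline L& W_{\overline{J^*}}\overline H_{G^*}-\gamma_R\gamma_J(1+\theta)W_{\overline{J^*}}\overline LW_{\overline R}\overline L^*\end{bmatrix}.$$ In the singular value decomposition $\overline L=X\Sigma_{\overline L}Y^*$, $X\in\mathbb{R}^{m\times m}$ and $Y\in\mathbb{R}^{n\times n}$ are orthogonal and the $l$ non-zero singular values are placed first on the diagonal of $\Sigma_{\overline L}$.
   Formalization: The identity M^k−M^∞=(M−M^∞)^k is stated for k≥1, as it fails at k=0 unless M^∞=0; in (ii) each eigenvalue is non-real, or is 0 with 2l<n+m (where 0 does occur); the formula for ρ is stated for l>0, as σ_min needs a non-zero singular value. *)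

(* Defs.v *)
From HB Require Import structures.
From mathcomp Require Import all_boot all_order all_algebra.
From mathcomp Require Import all_classical all_reals all_analysis.
From mathcomp Require Import complex.

Set Implicit Arguments.
Unset Strict Implicit.
Unset Printing Implicit Defensive.

Import Order.TTheory GRing.Theory Num.Theory.
Import numFieldNormedType.Exports.
Local Open Scope classical_set_scope.
Local Open Scope ring_scope.

(* R^n is 'cV[R]_n.  The library norm on matrices is the sup norm; it is used
   here only through its topology and the derivatives it induces, which do not
   depend on the choice of the norm.  Metric statements use [norm2]. *)
Definition dot (R : realType) n (x y : 'cV[R]_n) : R :=
  \sum_(i < n) x i ord0 * y i ord0.

Definition norm2 (R : realType) n (x : 'cV[R]_n) : R := Num.sqrt (dot x x).

Definition opnorm (R : realType) m n (A : 'M[R]_(m, n)) : R :=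
  sup [set norm2 (A *m x) | x in [set x : 'cV[R]_n | norm2 x <= 1]].

(** Convex analysis *)

Definition proper_fun (R : realType) n (f : 'cV[R]_n -> \bar R) : Prop :=
  (exists x, (f x < +oo)%E) /\ (forall x, (-oo < f x)%E).

Definition convex_efun (R : realType) n (f : 'cV[R]_n -> \bar R) : Prop :=
  forall (x y : 'cV[R]_n) (t : R), 0 < t -> t < 1 ->
    (f (t *: x + (1 - t) *: y)%R <= t%:E * f x + (1 - t)%:E * f y)%E.

Definition Gamma0 (R : realType) n (f : 'cV[R]_n -> \bar R) : Prop :=
  [/\ proper_fun f, convex_efun f & lower_semicontinuous f].

Definition strongly_convex (R : realType) n (b : R)
    (f : 'cV[R]_n -> \bar R) : Prop :=
  forall (x y : 'cV[R]_n) (t : R), 0 < t -> t < 1 ->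
    (f (t *: x + (1 - t) *: y)%R
       + (b / 2 * (t * (1 - t)) * norm2 (x - y) ^+ 2)%:E
     <= t%:E * f x + (1 - t)%:E * f y)%E.

Definition conjugate (R : realType) n (f : 'cV[R]_n -> \bar R)
    (v : 'cV[R]_n) : \bar R :=
  ereal_sup (range (fun x : 'cV[R]_n => ((dot x v)%:E - f x)%E)).

Definition subdiff (R : realType) n (f : 'cV[R]_n -> \bar R) (x : 'cV[R]_n)
    : set 'cV[R]_n :=
  [set g | forall y, (f x + (dot g (y - x)%R)%:E <= f y)%E].

Definition aff_hull (R : realType) n (C : set 'cV[R]_n) : set 'cV[R]_n :=
  [set x | exists (k : nat) (c : 'I_k -> R) (p : 'I_k -> 'cV[R]_n),
     [/\ forall i, C (p i), \sum_(i < k) c i = 1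
       & x = \sum_(i < k) c i *: p i]].

Definition rel_int (R : realType) n (C : set 'cV[R]_n) : set 'cV[R]_n :=
  [set x | C x /\ exists2 e : R, 0 < e &
     forall y, aff_hull C y -> norm2 (y - x) < e -> C y].

Definition par (R : realType) n (C : set 'cV[R]_n) : set 'cV[R]_n :=
  [set d | exists x y, [/\ aff_hull C x, aff_hull C y & d = x - y]].

Definition orth (R : realType) n (V : set 'cV[R]_n) : set 'cV[R]_n :=
  [set h | forall d, V d -> dot h d = 0].

Definition is_affine (R : realType) n (M : set 'cV[R]_n) : Prop :=
  M !=set0 /\ forall (x y : 'cV[R]_n) (t : R),
    M x -> M y -> M (t *: x + (1 - t) *: y).

(* For a linear subspace: the largest size of a free family inside it. *)
Definition set_dim (R : realType) n (T : set 'cV[R]_n) : nat :=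
  \max_(k < n.+1 | `[< exists X : k.-tuple 'cV[R]_n,
                         free X /\ forall i, T (tnth X i) >]) k.

Definition is_orth_proj (R : realType) n (P : 'M[R]_n) (T : set 'cV[R]_n)
    : Prop :=
  forall x, T (P *m x) /\ orth T (x - P *m x).

(* The (unique) matrix of the orthogonal projection, T being a subspace. *)
Definition oproj (R : realType) n (T : set 'cV[R]_n) : 'M[R]_n :=
  xget 0 [set P | is_orth_proj P T].

Definition polyhedral (R : realType) n (f : 'cV[R]_n -> \bar R) : Prop :=
  exists (k : nat) (A : 'M[R]_(k, n)) (a b : 'cV[R]_k),
    forall (x : 'cV[R]_n) (r : R),
      (f x <= r%:E)%E <->
      (forall i, (A *m x) i ord0 + a i ord0 * r <= b i ord0).

Definition locally_polyhedral (R : realType) n (f : 'cV[R]_n -> \bar R)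
    (x : 'cV[R]_n) : Prop :=
  exists2 q : 'cV[R]_n -> \bar R, polyhedral q & \forall y \near x, f y = q y.

(** C^2 functions and submanifolds *)

Definition grad (R : realType) n (f : 'cV[R]_n -> R) (x : 'cV[R]_n)
    : 'cV[R]_n :=
  \col_(i < n) 'D_(delta_mx i ord0) f x.

Definition hess (R : realType) n (f : 'cV[R]_n -> R) (x : 'cV[R]_n)
    : 'M[R]_n :=
  \matrix_(i < n, j < n) 'D_(delta_mx j ord0) (fun y => grad f y i ord0) x.

Definition C2_near (R : realType) n (f : 'cV[R]_n -> R) (x : 'cV[R]_n)
    : Prop :=
  \forall y \near x,
    [/\ differentiable f y, differentiable (grad f) y
      & {for y, continuous (hess f)}].

Definition C2_near_ereal (R : realType) n (f : 'cV[R]_n -> \bar R)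
    (x : 'cV[R]_n) : Prop :=
  (\forall y \near x, f y \is a fin_num) /\ C2_near (fine \o f) x.

(* Near x, M is the zero set of a C^2 submersion. *)
Definition C2_submanifold (R : realType) n (M : set 'cV[R]_n) (x : 'cV[R]_n)
    : Prop :=
  exists (k : nat) (Phi : 'cV[R]_n -> 'cV[R]_k),
    [/\ forall i, C2_near (fun y => Phi y i ord0) x,
        \rank (\matrix_(i < k, j < n)
                 grad (fun y => Phi y i ord0) x j ord0) = k
      & \forall y \near x, M y <-> Phi y = 0].

(* Velocities at x of the curves drawn on M. *)
Definition tangent_space (R : realType) n (M : set 'cV[R]_n) (x : 'cV[R]_n)
    : set 'cV[R]_n :=
  [set h | exists c : R -> 'cV[R]_n,
     [/\ c 0 = x, \forall t \near (0 : R), M (c t)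
       & is_derive (0 : R) (1 : R) c h]].

Definition C2_along (R : realType) n (f : 'cV[R]_n -> \bar R)
    (M : set 'cV[R]_n) (x : 'cV[R]_n) : Prop :=
  exists2 g : 'cV[R]_n -> R, C2_near g x &
    \forall y \near x, M y -> f y = (g y)%:E.

(* Outer and inner semicontinuity (Painleve-Kuratowski) along M. *)
Definition setvalued_continuous (R : realType) n
    (S : 'cV[R]_n -> set 'cV[R]_n) (M : set 'cV[R]_n) (x : 'cV[R]_n) : Prop :=
  (forall g : 'cV[R]_n,
     (forall U V, nbhs x U -> nbhs g V ->
        exists y g', [/\ U y, M y, S y g' & V g']) -> S x g) /\
  (forall g : 'cV[R]_n, S x g -> forall V, nbhs g V ->
     \forall y \near x, M y -> exists2 g', S y g' & V g').

(* T^f_x *)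
Definition psT (R : realType) n (f : 'cV[R]_n -> \bar R) (x : 'cV[R]_n)
    : set 'cV[R]_n :=
  orth (par (subdiff f x)).

Definition PSF (R : realType) n (f : 'cV[R]_n -> \bar R) (x : 'cV[R]_n)
    (M : set 'cV[R]_n) : Prop :=
  [/\ [/\ Gamma0 f, subdiff f x !=set0 & M x],
      C2_submanifold M x /\ C2_along f M x,
      tangent_space M x = psT f x
    & setvalued_continuous (subdiff f) M x].

(* The nearest point of M; for M a C^2 submanifold around x it exists and is
   unique for z close to x. *)
Definition nearest (R : realType) n (M : set 'cV[R]_n) (z : 'cV[R]_n)
    : 'cV[R]_n :=
  xget z [set y | M y /\ forall w, M w -> norm2 (z - y) <= norm2 (z - w)].

Definition has_second_derivative (R : realType) (phi : R -> R) (t a : R)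
    : Prop :=
  (\forall s \near t, derivable phi s 1) /\ is_derive t (1 : R) (derive1 phi) a.

(* The Riemannian Hessian is represented by the n x n matrix vanishing on the
   orthogonal complement of the tangent space. *)
Definition is_riem_hess (R : realType) n (M : set 'cV[R]_n)
    (f : 'cV[R]_n -> \bar R) (x : 'cV[R]_n) (H : 'M[R]_n) : Prop :=
  let T := tangent_space M x in
  [/\ H^T = H, forall h, T h -> T (H *m h), forall h, orth T h -> H *m h = 0
    & forall h, T h ->
        has_second_derivative
          (fun t : R => fine (f (nearest M (x + t *: h)))) 0
          (dot (H *m h) h)].

Definition riem_hess (R : realType) n (M : set 'cV[R]_n)
    (f : 'cV[R]_n -> \bar R) (x : 'cV[R]_n) : 'M[R]_n :=
  xget 0 [set H | is_riem_hess M f x H].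

(** Spectra *)

Definition cspectrum (R : realType) n (A : 'M[R]_n) : set R[i] :=
  [set z | eigenvalue (map_mx (real_complex R) A) z].

Definition spectral_radius (R : realType) n (A : 'M[R]_n) : R :=
  sup [set Normc.normc z | z in cspectrum A].

(* The diagonal of S carries the singular values, non-zero ones first. *)
Definition is_svd (R : realType) m n (A : 'M[R]_(m, n))
    (X : 'M[R]_m) (S : 'M[R]_(m, n)) (Y : 'M[R]_n) : Prop :=
  [/\ X *m X^T = 1%:M, Y *m Y^T = 1%:M, A = X *m S *m Y^T
    & forall (i : 'I_m) (j : 'I_n),
        [/\ i != j :> nat -> S i j = 0,
            i = j :> nat -> (i < \rank A)%N -> 0 < S i j
          & i = j :> nat -> (\rank A <= i)%N -> S i j = 0]].

Definition singular_value (R : realType) m n (A : 'M[R]_(m, n)) (s : R)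
    : Prop :=
  0 <= s /\ eigenvalue (A^T *m A) (s ^+ 2).

Definition sigma_min (R : realType) m n (A : 'M[R]_(m, n)) : R :=
  inf [set s | singular_value A s /\ s != 0].

(** The primal-dual setting *)

Definition grad_conj (R : realType) m (G : 'cV[R]_m -> \bar R) (v : 'cV[R]_m)
    : 'cV[R]_m :=
  grad (fine \o conjugate G) v.

Definition hess_conj (R : realType) m (G : 'cV[R]_m -> \bar R) (v : 'cV[R]_m)
    : 'M[R]_m :=
  hess (fine \o conjugate G) v.

Definition Rbar (R : realType) n m (Rf : 'cV[R]_n -> \bar R)
    (F : 'cV[R]_n -> R) (L : 'M[R]_(m, n)) (xs : 'cV[R]_n) (vs : 'cV[R]_m)
    (x : 'cV[R]_n) : \bar R :=
  (Rf x + (dot x (L^T *m vs + grad F xs)%R)%:E)%E.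

Definition Jbar (R : realType) n m (J G : 'cV[R]_m -> \bar R)
    (L : 'M[R]_(m, n)) (xs : 'cV[R]_n) (vs : 'cV[R]_m) (y : 'cV[R]_m)
    : \bar R :=
  (conjugate J y - (dot y (L *m xs - grad_conj G vs)%R)%:E)%E.

(* The matrix M_PD in terms of its constituents: WR, WJ are W_Rbar, W_Jbar,
   HF, HG the projected Hessians, Lb is Lbar. *)
Definition MPD (R : realType) n m (gR gJ theta : R) (WR HF : 'M[R]_n)
    (WJ HG : 'M[R]_m) (Lb : 'M[R]_(m, n)) : 'M[R]_(n + m) :=
  let HFb := 1%:M - gR *: HF in
  let HGb := 1%:M - gJ *: HG in
  block_mx
    (WR *m HFb)
    (- (gR *: (WR *m Lb^T)))
    ((gJ * (1 + theta)) *: (WJ *m Lb *m WR *m HFb)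
       - (theta * gJ) *: (WJ *m Lb))
    (WJ *m HGb - (gR * gJ * (1 + theta)) *: (WJ *m Lb *m WR *m Lb^T)).

(* Main.v *)
Require Import Defs.
From HB Require Import structures.
From mathcomp Require Import all_boot all_order all_algebra.
From mathcomp Require Import all_classical all_reals all_analysis.
From mathcomp Require Import complex ring lra.

Set Implicit Arguments.
Unset Strict Implicit.
Unset Printing Implicit Defensive.

Import Order.TTheory GRing.Theory Num.Theory.
Import numFieldNormedType.Exports.
Local Open Scope classical_set_scope.
Local Open Scope ring_scope.

(** For theta = 1 the relation z' = M z reads (V + B + S) z' = (V - C) z, where
    V = [gR^-1, -L^T; -L, gJ^-1] is positive definite, B and C = diag(HF, HG)
    are positive semidefinite and S is skew.  The step size condition gives
    C < 2 V.  Pairing an eigenvector with itself shows that an eigenvalue has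
    modulus < 1 or equals 1, and that on the fixed points B, C and S vanish, so
    that M and M^T have the same fixed points; hence M^k converges to the
    orthogonal projection onto them.  The geometric rate follows from the
    Cayley-Hamilton theorem.

    In the polyhedral case the tilted functions are constant on the manifolds
    near the solution, so their Riemannian Hessians vanish.  The eigenvalues of
    M other than 1 are then the roots of X^2 - (2 - (1 + theta) k) X + 1 - theta k,
    with k in ]0, 1[ a non-zero eigenvalue of gR gJ L L^T; these roots are
    non-real, of squared modulus 1 - theta k. *)

(** * Euclidean geometry and orthogonal projections *)

(** Equality of the fixed points of M and M^T carries the convergence. The orthogonal projection P
    onto them satisfies M P = P M = P, so M = P + N with P N = N P = 0, and 1 cannot sit in a Jordan
    block. Everything reduces to the eigenvalues of N = M - P, without a normal form of the
    nonsymmetric M. At k = 0 the identity M^k - P = N^k would read Id - P = Id, hence its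
    restriction to positive k. Likewise N vanishes on the fixed points, so in the polyhedral case 0
    is an eigenvalue of N as soon as 2l < n + m; it is the only real one and is set apart. The
    formula for the spectral radius is stated for l > 0, where a non-zero singular value exists. The
    projections, nearest points and Riemannian Hessians are chosen by [xget]. Existence is not
    established for them; instead each argument also covers the default value. *)

Section Euclid.
Context (R : realType).

Lemma dotC n (x y : 'cV[R]_n) : dot x y = dot y x.
Proof. by apply: eq_bigr => i _; rewrite mulrC. Qed.

Lemma dotDl n (x y z : 'cV[R]_n) : dot (x + y) z = dot x z + dot y z.
Proof. by rewrite -big_split; apply: eq_bigr => i _; rewrite mxE mulrDl. Qed.

Lemma dotDr n (x y z : 'cV[R]_n) : dot x (y + z) = dot x y + dot x z.
Proof. by rewrite dotC dotDl !(dotC x). Qed.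

Lemma dotZl n a (x y : 'cV[R]_n) : dot (a *: x) y = a * dot x y.
Proof. by rewrite mulr_sumr; apply: eq_bigr => i _; rewrite mxE mulrA. Qed.

Lemma dotZr n a (x y : 'cV[R]_n) : dot x (a *: y) = a * dot x y.
Proof. by rewrite dotC dotZl dotC. Qed.

Lemma dotNl n (x y : 'cV[R]_n) : dot (- x) y = - dot x y.
Proof. by rewrite -scaleN1r dotZl mulN1r. Qed.

Lemma dotNr n (x y : 'cV[R]_n) : dot x (- y) = - dot x y.
Proof. by rewrite dotC dotNl dotC. Qed.

Lemma dotBl n (x y z : 'cV[R]_n) : dot (x - y) z = dot x z - dot y z.
Proof. by rewrite dotDl dotNl. Qed.

Lemma dotBr n (x y z : 'cV[R]_n) : dot x (y - z) = dot x y - dot x z.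
Proof. by rewrite dotDr dotNr. Qed.

Lemma dot0l n (x : 'cV[R]_n) : dot 0 x = 0.
Proof. by rewrite -(scale0r 0) dotZl mul0r. Qed.

Lemma dot0r n (x : 'cV[R]_n) : dot x 0 = 0.
Proof. by rewrite dotC dot0l. Qed.

Lemma dot_ge0 n (x : 'cV[R]_n) : 0 <= dot x x.
Proof. by apply: sumr_ge0 => i _; rewrite -expr2 sqr_ge0. Qed.

Lemma dot_eq0 n (x : 'cV[R]_n) : (dot x x == 0) = (x == 0).
Proof.
apply/idP/eqP => [|->]; last by rewrite dot0l.
rewrite psumr_eq0 => [|i _]; last by rewrite -expr2 sqr_ge0.
move=> /allP h; apply/matrixP => i j; rewrite ord1 mxE; apply/eqP.
by have := h i (mem_index_enum _); rewrite /= mulf_eq0 orbb.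
Qed.

Lemma dot_gt0 n (x : 'cV[R]_n) : x != 0 -> 0 < dot x x.
Proof. by move=> x0; rewrite lt_neqAle dot_ge0 andbT eq_sym dot_eq0. Qed.

Lemma dot_mulmxl m n (A : 'M[R]_(m, n)) x y :
  dot (A *m x) y = dot x (A^T *m y).
Proof.
rewrite /dot; under eq_bigr => i _ do rewrite mxE mulr_suml.
rewrite exchange_big; apply: eq_bigr => j _ /=.
by rewrite mxE mulr_sumr; apply: eq_bigr => i _; rewrite mxE; ring.
Qed.

Lemma dot_mulmxr m n (A : 'M[R]_(m, n)) x y :
  dot x (A *m y) = dot (A^T *m x) y.
Proof. by rewrite dotC dot_mulmxl dotC. Qed.

Lemma dot_eq0_all n (x : 'cV[R]_n) : (forall y, dot x y = 0) -> x = 0.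
Proof. by move=> /(_ x)/eqP; rewrite dot_eq0 => /eqP. Qed.

Lemma dot_delta n (x : 'cV[R]_n) i : dot x (delta_mx i ord0) = x i ord0.
Proof.
rewrite /dot (bigD1 i)//= !mxE !eqxx mulr1 big1 ?addr0// => j ji.
by rewrite !mxE (negbTE ji) mulr0.
Qed.

Lemma norm2_ge0 n (x : 'cV[R]_n) : 0 <= norm2 x.
Proof. exact: sqrtr_ge0. Qed.

Lemma sqr_norm2 n (x : 'cV[R]_n) : norm2 x ^+ 2 = dot x x.
Proof. by rewrite sqr_sqrtr ?dot_ge0. Qed.

Lemma norm2_eq0 n (x : 'cV[R]_n) : (norm2 x == 0) = (x == 0).
Proof. by rewrite -dot_eq0 -sqr_norm2 expf_eq0. Qed.

Lemma norm2_0 n : norm2 (0 : 'cV[R]_n) = 0.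
Proof. by apply/eqP; rewrite norm2_eq0. Qed.

Lemma norm2Z n a (x : 'cV[R]_n) : norm2 (a *: x) = `|a| * norm2 x.
Proof.
by rewrite /norm2 dotZl dotZr mulrA -expr2 sqrtrM ?sqr_ge0// sqrtr_sqr.
Qed.

Lemma dot_le_norm2 n (x y : 'cV[R]_n) : dot x y <= norm2 x * norm2 y.
Proof.
have [->|x0] := eqVneq x 0; first by rewrite dot0l norm2_0 mul0r.
have [->|y0] := eqVneq y 0; first by rewrite dot0r norm2_0 mulr0.
have a0 : 0 < norm2 x by rewrite lt_neqAle norm2_ge0 eq_sym norm2_eq0 x0.
have b0 : 0 < norm2 y by rewrite lt_neqAle norm2_ge0 eq_sym norm2_eq0 y0.
have := dot_ge0 (norm2 y *: x - norm2 x *: y).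
rewrite dotBl !dotBr !dotZl !dotZr -!sqr_norm2 (dotC y x) => h.
have ab : 0 < norm2 x * norm2 y by rewrite mulr_gt0.
rewrite -(ler_pM2l ab); nra.
Qed.

Lemma entry_le_norm2 n (x : 'cV[R]_n) i : `|x i ord0| <= norm2 x.
Proof.
rewrite -sqrtr_sqr ler_sqrt ?dot_ge0// /dot (bigD1 i)//= -expr2 lerDl.
by apply: sumr_ge0 => j _; rewrite -expr2 sqr_ge0.
Qed.

Lemma norm2_le_sum n (x : 'cV[R]_n) : norm2 x <= \sum_i `|x i ord0|.
Proof.
have s0 : 0 <= \sum_i `|x i ord0| by apply: sumr_ge0.
rewrite -(@ler_pXn2r _ 2) ?nnegrE ?norm2_ge0// sqr_norm2 /dot expr2 mulr_suml.
apply: ler_sum => i _; rewrite (le_trans (ler_norm _))// normrM.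
by apply: ler_wpM2l => //; rewrite (bigD1 i)//= lerDl sumr_ge0.
Qed.

Lemma norm2_mulmx_le_sum m n (A : 'M[R]_(m, n)) x :
  norm2 (A *m x) <= (\sum_i \sum_j `|A i j|) * norm2 x.
Proof.
rewrite (le_trans (norm2_le_sum _))// mulr_suml; apply: ler_sum => i _.
rewrite mxE (le_trans (ler_norm_sum _ _ _))// mulr_suml; apply: ler_sum => j _.
by rewrite normrM ler_wpM2l// entry_le_norm2.
Qed.

Lemma opnorm_has_sup m n (A : 'M[R]_(m, n)) :
  has_sup [set norm2 (A *m x) | x in [set x : 'cV[R]_n | norm2 x <= 1]].
Proof.
split; first by exists (norm2 (A *m 0)), 0 => //=; rewrite norm2_0.
exists (\sum_i \sum_j `|A i j|) => _ [x /= x1 <-].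
rewrite (le_trans (norm2_mulmx_le_sum _ _))// ler_piMr//.
by apply: sumr_ge0 => i _; apply: sumr_ge0.
Qed.

Lemma opnorm_le_sum m n (A : 'M[R]_(m, n)) : opnorm A <= \sum_i \sum_j `|A i j|.
Proof.
apply: ge_sup; first exact: (opnorm_has_sup A).1.
move=> _ [x /= x1 <-]; rewrite (le_trans (norm2_mulmx_le_sum _ _))// ler_piMr//.
by apply: sumr_ge0 => i _; apply: sumr_ge0.
Qed.

Lemma opnorm_ge0 m n (A : 'M[R]_(m, n)) : 0 <= opnorm A.
Proof.
have h : norm2 (A *m 0) <= opnorm A.
  by apply: (ub_le_sup (opnorm_has_sup A).2); exists 0 => //=; rewrite norm2_0.
exact: le_trans (norm2_ge0 _) h.
Qed.

Lemma norm2_mulmx_le m n (A : 'M[R]_(m, n)) x :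
  norm2 (A *m x) <= opnorm A * norm2 x.
Proof.
have [->|x0] := eqVneq x 0; first by rewrite mulmx0 !norm2_0 mulr0.
have a0 : 0 < norm2 x by rewrite lt_neqAle norm2_ge0 eq_sym norm2_eq0 x0.
rewrite -ler_pdivrMr// mulrC -[(norm2 x)^-1]ger0_norm ?invr_ge0 ?norm2_ge0//.
rewrite -norm2Z scalemxAr.
apply: (ub_le_sup (opnorm_has_sup A).2); exists ((norm2 x)^-1 *: x) => //=.
by rewrite norm2Z ger0_norm ?invr_ge0 ?norm2_ge0// mulVf ?lt0r_neq0.
Qed.

(** Moving A^T across the product, |A^T y|^2 = <y, A A^T y> <= |y| b |A^T y|; then divide by |A^T
    y|. *)
Lemma norm2_trmx_mulmx_le m n (A : 'M[R]_(m, n)) b :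
  0 <= b -> (forall x, norm2 (A *m x) <= b * norm2 x) ->
  forall y, norm2 (A^T *m y) <= b * norm2 y.
Proof.
move=> b0 hA y; have [->|z0] := eqVneq (A^T *m y) 0.
  by rewrite norm2_0 mulr_ge0 ?norm2_ge0.
have a0 : 0 < norm2 (A^T *m y) by rewrite lt_neqAle norm2_ge0 eq_sym norm2_eq0 z0.
rewrite -(ler_pM2l a0) -expr2 sqr_norm2 dot_mulmxl trmxK.
rewrite (le_trans (dot_le_norm2 _ _))// mulrCA mulrA [X in _ <= X]mulrC ler_wpM2l ?norm2_ge0//.
Qed.

Definition sym_psd n (A : 'M[R]_n) :=
  A^T = A /\ forall x, 0 <= dot x (A *m x).

Lemma sym_psd0 n : sym_psd (0 : 'M[R]_n).
Proof. by split=> [|x]; rewrite ?trmx0// mul0mx dot0r. Qed.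

Lemma sym_psdZ n a (A : 'M[R]_n) : 0 <= a -> sym_psd A -> sym_psd (a *: A).
Proof.
move=> a0 [sA pA]; split=> [|x]; first by rewrite linearZ/= sA.
by rewrite -scalemxAl dotZr mulr_ge0.
Qed.

Lemma dot_symC n (A : 'M[R]_n) x y : A^T = A -> dot x (A *m y) = dot y (A *m x).
Proof. by move=> sA; rewrite dot_mulmxr sA dotC. Qed.

(** At x + t A x the form equals t (t b + 2 a) with a = |A x|^2. It must be nonnegative for all t,
    which a small negative t refutes if a > 0. *)
Lemma sym_psd_ker n (A : 'M[R]_n) x :
  sym_psd A -> dot x (A *m x) = 0 -> A *m x = 0.
Proof.
move=> [sA pA] h0; apply/eqP; rewrite -dot_eq0; apply/eqP.
set a := dot (A *m x) (A *m x); set b := dot (A *m x) (A *m (A *m x)).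
have a0 : 0 <= a by exact: dot_ge0.
have b0 : 0 <= b by exact: pA.
have h t : 0 <= t * (t * b + a *+ 2).
  have := pA (x + t *: (A *m x)).
  rewrite mulmxDr -scalemxAr dotDl !dotDr !dotZl !dotZr h0 (dot_symC x (A *m x) sA).
  by rewrite -/a -/b; lra.
apply/eqP; rewrite eq_le a0 andbT leNgt; apply/negP => ap.
(* The added 1 keeps the denominator positive when b = 0, and t b + 2 a stays positive at this t. *)
have := h (- (a / (b + 1))); apply/negP; rewrite -ltNge.
have b1 : 0 < b + 1 by lra.
rewrite nmulr_rlt0 ?oppr_lt0 ?divr_gt0//.
have -> : - (a / (b + 1)) * b + a *+ 2 = a * (b + 2) / (b + 1).
  by field; rewrite lt0r_neq0.
by rewrite divr_gt0// mulr_gt0//; lra.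
Qed.

Definition orth_projector n (P : 'M[R]_n) := P^T = P /\ P *m P = P.

Lemma mulmx_cV_inj m n (A B : 'M[R]_(m, n)) :
  (forall x : 'cV[R]_n, A *m x = B *m x) -> A = B.
Proof.
move=> h; apply/matrixP => i j.
by have /matrixP/(_ i ord0) := h (delta_mx j ord0); rewrite -!colE !mxE.
Qed.

Lemma dot_mulmx_inj m n (A B : 'M[R]_(m, n)) :
  (forall x y, dot x (A *m y) = dot x (B *m y)) -> A = B.
Proof.
move=> h; apply: mulmx_cV_inj => y; apply/subr0_eq/dot_eq0_all => x.
by rewrite dotC dotBr h subrr.
Qed.

Lemma unitmx_cV n (A : 'M[R]_n) :
  (forall x : 'cV[R]_n, A *m x = 0 -> x = 0) -> A \in unitmx.
Proof.
move=> h; rewrite -unitmx_tr -row_free_unit; apply: inj_row_free => v.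
move/(congr1 trmx); rewrite trmx_mul trmxK trmx0 => /h vT.
by apply: trmx_inj; rewrite trmx0.
Qed.

(** Since x - P x is orthogonal to all values of P, P = P^T P. This forces symmetry, then
    idempotence. *)
Lemma is_orth_proj_projector n (P : 'M[R]_n) T :
  is_orth_proj P T -> orth_projector P.
Proof.
move=> hP; have PE : P = P^T *m P.
  apply: dot_mulmx_inj => x y; rewrite -mulmxA -dot_mulmxl; apply/eqP.
  by rewrite -subr_eq0 -dotBl (hP x).2//; exact: (hP y).1.
have PT : P^T = P by rewrite {1}PE trmx_mul trmxK -PE.
by split=> //; rewrite -{1}PT -PE.
Qed.

Lemma is_orth_proj_id n (P : 'M[R]_n) T x :
  (forall x y, T x -> T y -> T (x - y)) -> is_orth_proj P T ->
  T x -> P *m x = x.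
Proof.
move=> TB hP Tx; have [TPx] := hP x; move/(_ (x - P *m x)) => /(_ (TB _ _ Tx TPx)).
by move/eqP; rewrite dot_eq0 subr_eq0 => /eqP.
Qed.

Lemma is_orth_proj_uniq n (P Q : 'M[R]_n) T :
  (forall x y, T x -> T y -> T (x - y)) -> is_orth_proj P T ->
  is_orth_proj Q T -> P = Q.
Proof.
move=> TB hP hQ.
have [sP _] := is_orth_proj_projector hP.
have [sQ _] := is_orth_proj_projector hQ.
have PQ : P *m Q = Q.
  apply: mulmx_cV_inj => x; rewrite -mulmxA.
  by apply: (is_orth_proj_id TB hP); exact: (hQ x).1.
have QP : Q *m P = P.
  apply: mulmx_cV_inj => x; rewrite -mulmxA.
  by apply: (is_orth_proj_id TB hQ); exact: (hP x).1.
by rewrite -[LHS]QP -sP -{1}sQ -trmx_mul PQ.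
Qed.

(** A rank factorization A = U B, with U left invertible and B of full row rank, gives ker A = ker
    B. The Gram matrix B B^T is then invertible and Id - B^T (B B^T)^-1 B is the projection. *)
Lemma exists_orth_proj_ker p n (A : 'M[R]_(p, n)) :
  exists P, is_orth_proj P [set z : 'cV[R]_n | A *m z = 0].
Proof.
have [r [U [B [AE [C CU] Bfree]]]] : exists r (U : 'M[R]_(p, r)) (B : 'M[R]_(r, n)),
    [/\ A = U *m B, exists C, C *m U = 1%:M & row_free B].
  exists (\rank A), (col_base A), (row_base A); rewrite mulmx_base row_base_free.
  by split=> //; apply/row_fullP; exact: col_base_full.
have BU : B *m B^T \in unitmx.
  apply: unitmx_cV => x /(congr1 (dot x)); rewrite dot0r -mulmxA -[B]trmxK.
  rewrite -dot_mulmxl trmxK => /eqP; rewrite dot_eq0 => /eqP/(congr1 trmx).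
  rewrite trmx_mul trmxK trmx0 => h; apply: trmx_inj; rewrite trmx0.
  by apply: (row_free_inj Bfree); rewrite h mul0mx.
have BE (z : 'cV[R]_n) : A *m z = 0 -> B *m z = 0.
  by rewrite AE -mulmxA => /(congr1 (mulmx C)); rewrite mulmxA CU mul1mx mulmx0.
exists (1%:M - B^T *m invmx (B *m B^T) *m B) => x; split=> /=.
  rewrite AE mulmxBl mul1mx mulmxBr -!mulmxA (mulmxA B B^T) mulKVmx//.
  by rewrite subrr.
move=> d /= /BE Bd.
rewrite mulmxBl mul1mx opprB addrC subrK -!mulmxA dot_mulmxl trmxK Bd.
by rewrite dot0r.
Qed.

Lemma norm2_projector_le n (P : 'M[R]_n) x :
  orth_projector P -> norm2 (P *m x) <= norm2 x.
Proof.
move=> [sP iP]; rewrite ler_sqrt ?dot_ge0// dot_mulmxl sP mulmxA iP.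
have := dot_ge0 (x - P *m x); rewrite dotBl !dotBr.
rewrite (dot_mulmxl P x (P *m x)) sP mulmxA iP (dot_mulmxl P x x) sP.
lra.
Qed.

(** The default 0 of [oproj] is symmetric and idempotent too, so the estimates below hold in either
    case. *)
Lemma oproj_projector n (T : set 'cV[R]_n) : orth_projector (oproj T).
Proof.
rewrite /oproj; case: xgetP => [P _ /is_orth_proj_projector//|_].
by split; rewrite ?trmx0 ?mulmx0.
Qed.

Lemma sym_psd_proj n (P A : 'M[R]_n) :
  P^T = P -> sym_psd A -> sym_psd (P *m A *m P).
Proof.
move=> sP [sA pA]; split=> [|x]; first by rewrite !trmx_mul sP sA mulmxA.
by rewrite -!mulmxA dot_mulmxr sP.
Qed.

End Euclid.

(** * Complex spectrum and powers of a real matrix *)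

Section Spectrum.
Context (R : realType).
Local Notation C := R[i].
Local Notation toC := (map_mx (real_complex R)).

Definition cplx_mx m n (x y : 'M[R]_(m, n)) : 'M[C]_(m, n) :=
  toC x + ('i : C) *: toC y.

Lemma cplx_mxE m n (x y : 'M[R]_(m, n)) i j :
  cplx_mx x y i j = Complex (x i j) (y i j).
Proof. by rewrite !mxE [RHS]complexE. Qed.

Lemma cplx_mx_Re_Im m n (v : 'M[C]_(m, n)) :
  v = cplx_mx (map_mx (@complex.Re R) v) (map_mx (@complex.Im R) v).
Proof. by apply/matrixP => i j; rewrite cplx_mxE !mxE; case: (v i j). Qed.

Lemma cplx_mx_inj m n (x y x' y' : 'M[R]_(m, n)) :
  cplx_mx x y = cplx_mx x' y' -> x = x' /\ y = y'.
Proof.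
move=> /matrixP h; split; apply/matrixP => i j;
by have := h i j; rewrite !cplx_mxE => -[].
Qed.

Lemma mulmx_cplx m n p (A : 'M[R]_(m, n)) (x y : 'M[R]_(n, p)) :
  toC A *m cplx_mx x y = cplx_mx (A *m x) (A *m y).
Proof. by rewrite /cplx_mx mulmxDr -scalemxAr !map_mxM. Qed.

Lemma scale_cplx m n (a b : R) (x y : 'M[R]_(m, n)) :
  (Complex a b) *: cplx_mx x y = cplx_mx (a *: x - b *: y) (b *: x + a *: y).
Proof.
apply/matrixP => i j; rewrite mxE !cplx_mxE !mxE.
by rewrite [b * _ + _]addrC.
Qed.

Lemma eigenvalue_trmx (F : fieldType) n (A : 'M[F]_n) z :
  eigenvalue A^T z = eigenvalue A z.
Proof.
rewrite !eigenvalue_root_char /char_poly -det_tr; congr (root (\det _) _).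
by rewrite /char_poly_mx linearB/= tr_scalar_mx -map_trmx trmxK.
Qed.

(** [eigenvalue] speaks of row vectors, hence the passage through A^T. Splitting a complex
    eigenvector into x + i y leaves two real equations, to which [dot] applies. *)
Lemma cspectrumP n (A : 'M[R]_n) (z : C) :
  cspectrum A z <-> exists x y : 'cV[R]_n,
    [/\ (x != 0) || (y != 0),
        A *m x = complex.Re z *: x - complex.Im z *: y
      & A *m y = complex.Im z *: x + complex.Re z *: y].
Proof.
rewrite /cspectrum /= -eigenvalue_trmx; case: z => a b /=; split.
  case/eigenvalueP => v /(congr1 trmx); rewrite trmx_mul trmxK linearZ/= => Av v0.
  move: Av; rewrite (cplx_mx_Re_Im v^T) mulmx_cplx scale_cplx.
  set x := map_mx _ _; set y := map_mx _ _ => /cplx_mx_inj[Ax Ay].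
  exists x, y; split=> //; apply: contraNT v0.
  rewrite negb_or !negbK => /andP[/eqP x0 /eqP y0].
  apply/eqP/trmx_inj; rewrite trmx0 (cplx_mx_Re_Im v^T) -/x -/y x0 y0.
  by rewrite /cplx_mx map_mx0 scaler0 addr0.
move=> [x [y [xy0 Ax Ay]]]; apply/eigenvalueP; exists (cplx_mx x y)^T.
  by rewrite -trmx_mul mulmx_cplx Ax Ay -scale_cplx linearZ.
apply: contraTN xy0 => /eqP/(congr1 trmx); rewrite trmxK trmx0.
have -> : 0 = cplx_mx 0 0 :> 'cV[C]_n.
  by rewrite /cplx_mx map_mx0 scaler0 addr0.
by case/cplx_mx_inj => -> ->; rewrite eqxx.
Qed.

Lemma normcE_complex (a b : R) : Normc.normc (Complex a b) = Num.sqrt (a ^+ 2 + b ^+ 2).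
Proof. by []. Qed.

Lemma normc_ge0 (z : C) : 0 <= Normc.normc z.
Proof. by case: z => a b; exact: sqrtr_ge0. Qed.

Lemma normc_real (a : R) : Normc.normc (a%:C)%C = `|a|.
Proof. by rewrite /= expr0n addr0 sqrtr_sqr. Qed.

Lemma normc_addl (x y : C) :
  Normc.normc (x + y) <= Normc.normc x + Normc.normc y.
Proof. exact: (@le_normcD R x y). Qed.

Lemma char_poly_split n (A : 'M[C]_n) :
  {rs : seq C | char_poly A = \prod_(z <- rs) ('X - z%:P)}.
Proof.
have [rs E] := closed_field_poly_normal (char_poly A).
by exists rs; move: E; rewrite (monicP (char_poly_monic A)) scale1r.
Qed.

Lemma cspectrum_finite n (A : 'M[R]_n) :
  exists rs : seq C, forall z, cspectrum A z <-> z \in rs.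
Proof.
have [rs E] := char_poly_split (toC A); exists rs => z.
by rewrite /cspectrum /= eigenvalue_root_char E root_prod_XsubC.
Qed.

Lemma seq_normc_le (rs : seq C) (b : R) :
  0 < b -> (forall z, z \in rs -> Normc.normc z < b) ->
  exists2 c, c < b & forall z, z \in rs -> Normc.normc z <= c.
Proof.
move=> b0; elim: rs => [|z rs IH] h; first by exists 0.
have [|c cb hc] := IH; first by move=> w wrs; apply: h; rewrite inE wrs orbT.
exists (Num.max c (Normc.normc z)); first by rewrite gt_max cb h// mem_head.
move=> w; rewrite inE => /predU1P[->|/hc wc]; first by rewrite le_max lexx orbT.
by rewrite le_max wc.
Qed.

Lemma normc_le_spectral_radius n (A : 'M[R]_n) z :
  cspectrum A z -> Normc.normc z <= spectral_radius A.
Proof.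
move=> zA; have [rs rsE] := cspectrum_finite A.
apply: ub_le_sup; last by exists z.
exists (\sum_(w <- rs) Normc.normc w) => _ [w /rsE wrs <-].
by rewrite (big_rem w wrs)/= lerDl sumr_ge0// => ? _; exact: normc_ge0.
Qed.

(** A supremum of values below b could equal b; finiteness of the spectrum yields a uniform bound c
    < b. Positivity of b settles the empty spectrum, where [sup] is 0. *)
Lemma spectral_radius_lt n (A : 'M[R]_n) (b : R) : 0 < b ->
  (forall z, cspectrum A z -> Normc.normc z < b) -> spectral_radius A < b.
Proof.
move=> b0 h; have [rs rsE] := cspectrum_finite A.
have [|c cb hc] := @seq_normc_le rs b b0; first by move=> z /rsE /h.
rewrite /spectral_radius; have [->|/set0P[z0 z0A]] := eqVneq (cspectrum A) set0.
  by rewrite image_set0 sup0.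
apply: le_lt_trans cb; apply: ge_sup; first by exists (Normc.normc z0), z0.
by move=> _ [z /rsE /hc zc <-].
Qed.

Lemma spectral_radius_eq n (A : 'M[R]_n) (b : R) :
  (forall z, cspectrum A z -> Normc.normc z <= b) ->
  (exists2 z, cspectrum A z & Normc.normc z = b) -> spectral_radius A = b.
Proof.
move=> h [z zA zb]; apply/eqP; rewrite eq_le -{2}zb normc_le_spectral_radius//.
rewrite andbT; apply: ge_sup; first by exists (Normc.normc z), z.
by move=> _ [w wA <-]; exact: h.
Qed.

(* Multiplying by A - z turns the sequence u_k = A^k Q into the sequence
   u_(k+1) - z u_k, so the roots can be removed one at a time. *)
Lemma power_rate_roots n (A : 'M[C]_n) (r : R) (rs : seq C) :
  (forall z, z \in rs -> Normc.normc z < r) -> forall Q : 'M[C]_n,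
  foldl (fun Q z => (A - z%:M) *m Q) Q rs = 0 ->
  exists c : R, forall k i j, Normc.normc ((A ^+ k *m Q) i j) <= c * r ^+ k.
Proof.
elim: rs => [|z rs IH] hr Q /= h0.
  by exists 0 => k i j; rewrite h0 mulmx0 mxE Normc.normc0 mul0r.
have zr : Normc.normc z < r by rewrite hr// mem_head.
have r0 : 0 < r by exact: le_lt_trans (normc_ge0 z) zr.
have [|c hc] := IH _ _ h0; first by move=> w wrs; rewrite hr// inE wrs orbT.
pose q := \sum_i \sum_j Normc.normc (Q i j).
(* The term q covers k = 0. The other one gives c <= c1 (r - |z|), so that c r^k + |z| c1 r^k <= c1
   r^(k+1). *)
pose c1 := Num.max q (c / (r - Normc.normc z)).
exists c1; elim=> [|k IHk] i j.
  rewrite expr0 mul1mx expr0 mulr1 /c1 le_max; apply/orP; left.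
  rewrite /q (bigD1 i)//= (bigD1 j)//= -addrA lerDl addr_ge0 ?sumr_ge0// => *.
  - exact: normc_ge0.
  - by apply: sumr_ge0 => *; exact: normc_ge0.
have -> : A ^+ k.+1 *m Q = A ^+ k *m ((A - z%:M) *m Q) + z *: (A ^+ k *m Q).
  rewrite exprSr -mulmxE mulmxBl mulmxBr mul_scalar_mx -scalemxAr subrK.
  by rewrite mulmxA.
rewrite !mxE (le_trans (normc_addl _ _))// Normc.normcM.
have := hc k i j; have := IHk i j; rewrite !mxE => h1 h2.
have c1c : c <= c1 * (r - Normc.normc z).
  by rewrite -ler_pdivrMr ?subr_gt0// /c1 le_max lexx orbT.
have rk : 0 <= r ^+ k by rewrite exprn_ge0// ltW.
rewrite exprS; have z0 := normc_ge0 z.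
apply: (le_trans (lerD h2 (ler_wpM2l z0 h1))).
have := ler_wpM2r rk c1c; lra.
Qed.

Lemma foldl_horner_mx n (A Q : 'M[C]_n.+1) (rs : seq C) :
  foldl (fun Q z => (A - z%:M) *m Q) Q rs =
  horner_mx A (\prod_(z <- rs) ('X - z%:P)) *m Q.
Proof.
elim: rs Q => [|z rs IH] Q /=; first by rewrite big_nil rmorph1 mul1mx.
rewrite IH big_cons mulrC rmorphM/= rmorphB/= horner_mx_X horner_mx_C.
by rewrite mulmxA.
Qed.

(** The factors of the characteristic polynomial, applied in turn to A, give 0 by Cayley-Hamilton.
    The strict inequality absorbs the polynomial factors that multiple roots would produce. *)
Lemma power_rate n (A : 'M[R]_n) (r : R) : spectral_radius A < r ->
  exists c : R, forall k i j, `|(A ^+ k) i j| <= c * r ^+ k.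
Proof.
case: n A => [|n] A hr; first by exists 0 => k [].
have [rs E] := char_poly_split (toC A).
have [||c hc] := @power_rate_roots _ (toC A) r rs _ 1%:M.
- move=> z zrs; apply: le_lt_trans hr; apply: normc_le_spectral_radius.
  by rewrite /cspectrum /= eigenvalue_root_char E root_prod_XsubC.
- by rewrite foldl_horner_mx -E Cayley_Hamilton mul0mx.
exists c => k i j; have := hc k i j.
by rewrite mulmx1 -rmorphXn mxE normc_real.
Qed.

Lemma opnorm_power_rate n (A : 'M[R]_n) (r : R) : spectral_radius A < r ->
  exists c : R, forall k, opnorm (A ^+ k) <= c * r ^+ k.
Proof.
move=> /power_rate[c hc]; exists (\sum_(i < n) \sum_(j < n) c) => k.
rewrite (le_trans (opnorm_le_sum _))// mulr_suml; apply: ler_sum => i _.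
by rewrite mulr_suml; apply: ler_sum => j _.
Qed.

End Spectrum.

(** * Powers of a matrix whose fixed points are also fixed by its transpose *)

Section Convergence.
Context (R : realType).

Lemma fixed_pointsE n (M : 'M[R]_n) :
  [set z : 'cV[R]_n | M *m z = z] = [set z | (M - 1%:M) *m z = 0].
Proof.
apply/seteqP; split => z /=; rewrite mulmxBl mul1mx => /eqP.
  by move=> /eqP ->; rewrite subrr.
by rewrite subr_eq0 => /eqP.
Qed.

Lemma fixed_pointsB n (M : 'M[R]_n) (x y : 'cV[R]_n) :
  M *m x = x -> M *m y = y -> M *m (x - y) = x - y.
Proof. by rewrite mulmxBr => -> ->. Qed.

Lemma exists_orth_proj_fixed n (M : 'M[R]_n) :
  exists P, is_orth_proj P [set z : 'cV[R]_n | M *m z = z].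
Proof. by rewrite fixed_pointsE; exact: exists_orth_proj_ker. Qed.

Section FixedProjection.
Context n (M P : 'M[R]_n).
Hypothesis hP : is_orth_proj P [set z : 'cV[R]_n | M *m z = z].
Hypothesis hM : forall z : 'cV[R]_n, M *m z = z -> M^T *m z = z.

Lemma fixed_proj_id (x : 'cV[R]_n) : M *m x = x -> P *m x = x.
Proof. exact: (is_orth_proj_id (@fixed_pointsB _ M) hP). Qed.

Lemma mulmx_fixed_proj : M *m P = P.
Proof. by apply: mulmx_cV_inj => x; rewrite -mulmxA; exact: (hP x).1. Qed.

(** The hypothesis [hM] says M^T P = P, and P is symmetric: transposing gives the claim. Together
    with M P = P it makes P commute with M. *)
Lemma fixed_proj_mulmx : P *m M = P.
Proof.
have [sP _] := is_orth_proj_projector hP.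
apply: trmx_inj; rewrite trmx_mul sP.
by apply: mulmx_cV_inj => x; rewrite -mulmxA; apply: hM; exact: (hP x).1.
Qed.

Lemma fixed_proj_idem : P *m P = P.
Proof. exact: (is_orth_proj_projector hP).2. Qed.

(** For k = 0 the left side is Id - P and the right side Id, so the identity starts at k = 1. *)
Lemma fixed_proj_power k : (0 < k)%N -> M ^+ k - P = (M - P) ^+ k.
Proof.
case: k => // k _; elim: k => [|k IH]; first by rewrite !expr1.
rewrite exprS [RHS]exprS -IH -!mulmxE mulmxBl !mulmxBr mulmx_fixed_proj.
rewrite fixed_proj_idem.
have -> : P *m M ^+ k.+1 = P.
  elim: k {IH} => [|k IH]; first by rewrite expr1 fixed_proj_mulmx.
  by rewrite exprS -mulmxE mulmxA fixed_proj_mulmx.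
by rewrite subrr subr0.
Qed.

(** P (M - P) = 0, so applying P to the eigenvector equation gives z P(x + i y) = 0. As z is
    non-zero, P kills x and y, on which M - P and M then agree. *)
Lemma cspectrum_sub_proj z : cspectrum (M - P) z -> z != 0 ->
  exists x y : 'cV[R]_n,
    [/\ (x != 0) || (y != 0), P *m x = 0, P *m y = 0,
        M *m x = complex.Re z *: x - complex.Im z *: y
      & M *m y = complex.Im z *: x + complex.Re z *: y].
Proof.
move=> /cspectrumP[x [y [xy0 Nx Ny]]] z0; exists x, y.
have PN (w : 'cV_n) : P *m ((M - P) *m w) = 0.
  by rewrite mulmxA mulmxBr fixed_proj_mulmx fixed_proj_idem subrr mul0mx.
have := PN x; rewrite Nx mulmxBr -!scalemxAr => h1.
have := PN y; rewrite Ny mulmxDr -!scalemxAr => h2.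
have zz : complex.Re z ^+ 2 + complex.Im z ^+ 2 != 0.
  apply: contraNneq z0; case: z {Nx Ny h1 h2} => a b /= /eqP.
  rewrite paddr_eq0 ?sqr_ge0// !sqrf_eq0 => /andP[/eqP-> /eqP->].
  by [].
have Px : P *m x = 0.
  apply: (scalerI zz); rewrite scaler0.
  (* Real part of the conjugate of z times z P(x + i y); the imaginary part is used for y below. *)
  transitivity (complex.Re z *: (complex.Re z *: (P *m x) - complex.Im z *: (P *m y))
    + complex.Im z *: (complex.Im z *: (P *m x) + complex.Re z *: (P *m y))).
    by apply/matrixP => i j; rewrite !mxE; ring.
  by rewrite h1 h2 !scaler0 addr0.
have Py : P *m y = 0.
  apply: (scalerI zz); rewrite scaler0.
  transitivity (complex.Re z *: (complex.Im z *: (P *m x) + complex.Re z *: (P *m y))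
    - complex.Im z *: (complex.Re z *: (P *m x) - complex.Im z *: (P *m y))).
    by apply/matrixP => i j; rewrite !mxE; ring.
  by rewrite h1 h2 !scaler0 subr0.
by split=> //; rewrite -?Nx -?Ny mulmxBl ?Px ?Py subr0.
Qed.

Lemma cspectrum_sub_proj_neq1 : ~ cspectrum (M - P) 1.
Proof.
move=> /cspectrum_sub_proj /(_ (oner_neq0 _))[x [y [xy0 Px Py /=]]].
rewrite !scale1r !scale0r subr0 add0r => /fixed_proj_id xE /fixed_proj_id yE.
by move: xy0; rewrite -xE -yE Px Py eqxx.
Qed.

Lemma cvg_fixed_proj : spectral_radius (M - P) < 1 ->
  (fun k : nat => M ^+ k) @ \oo --> P.
Proof.
(* The maximum with 0 makes the ratio r nonnegative, as the geometric bound requires. *)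
move=> sr1; pose s := Num.max (spectral_radius (M - P)) 0.
have s1 : s < 1 by rewrite gt_max sr1 ltr01.
pose r := (s + 1) / 2.
have s0 : 0 <= s by rewrite le_max lexx orbT.
have sr : spectral_radius (M - P) <= s by rewrite le_max lexx.
have [|c hc] := @power_rate R n (M - P) r; first by rewrite /r; lra.
apply/cvg_ballP => e e0.
have : (fun k => (`|c| + 1) * r ^+ k) @ \oo --> 0.
  by apply: cvg_geometric; rewrite ger0_norm /r; lra.
move=> /cvgrPdist_lt/(_ e e0) => hk.
near=> k; split=> // i j; rewrite /ball /= distrC.
have k0 : (0 < k)%N by near: k; exact: nbhs_infty_gt.
have := hc k i j; rewrite -fixed_proj_power// !mxE => /le_lt_trans; apply.
have : `|0 - (`|c| + 1) * r ^+ k| < e by near: k.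
rewrite sub0r normrN; apply: le_lt_trans.
rewrite (le_trans _ (ler_norm _))// ler_wpM2r//.
  by rewrite exprn_ge0// /r; lra.
by rewrite (le_trans (ler_norm _))// lerDl.
Unshelve. all: by end_near. Qed.

End FixedProjection.
End Convergence.

(** * The primal-dual matrix *)

Section PrimalDualMatrix.
Context (R : realType) (n m : nat).
Implicit Types (x : 'cV[R]_n) (v : 'cV[R]_m).

Lemma dot_col_mx x y (v w : 'cV[R]_m) :
  dot (col_mx x v) (col_mx y w) = dot x y + dot v w.
Proof.
rewrite /dot big_split_ord /=; congr (_ + _); apply: eq_bigr => i _.
  by rewrite !col_mxEu.
by rewrite !col_mxEd.
Qed.

Lemma col_mxP (z : 'cV[R]_(n + m)) : exists x v, z = col_mx x v.
Proof. by exists (usubmx z), (dsubmx z); rewrite vsubmxK. Qed.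

Lemma eq_col_mx_inv x y (v w : 'cV[R]_m) :
  col_mx x v = col_mx y w -> x = y /\ v = w.
Proof. by move=> /eq_col_mx[]. Qed.

Lemma sym_psd_add1_unit k (H : 'M[R]_k) : sym_psd H -> 1%:M + H \in unitmx.
Proof.
move=> [sH pH]; apply: unitmx_cV => x; rewrite mulmxDl mul1mx => h.
apply/eqP; rewrite -dot_eq0 eq_le dot_ge0 andbT.
have := pH x; have : dot x (x + H *m x) = 0 by rewrite h dot0r.
by rewrite dotDr; lra.
Qed.

Context (gR gJ theta : R) (HR HF : 'M[R]_n) (HJ HG : 'M[R]_m) (L : 'M[R]_(m, n)).
Let M := MPD gR gJ theta (invmx (1%:M + HR)) HF (invmx (1%:M + HJ)) HG L.
Hypotheses (gR0 : 0 < gR) (gJ0 : 0 < gJ).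
Hypotheses (pR : sym_psd HR) (pJ : sym_psd HJ) (pF : sym_psd HF) (pG : sym_psd HG).

(** Undoing the resolvents turns the block matrix back into one linearized primal-dual step: the
    products W_J L W_R in its second row come from the extrapolated point (1 + theta) x' - theta
    x. *)
Lemma MPD_mulE x v x' v' : M *m col_mx x v = col_mx x' v' <->
  (1%:M + HR) *m x' = x - gR *: (HF *m x) - gR *: (L^T *m v) /\
  (1%:M + HJ) *m v' = v - gJ *: (HG *m v)
     + gJ *: (L *m ((1 + theta) *: x' - theta *: x)).
Proof.
have uR := sym_psd_add1_unit pR; have uJ := sym_psd_add1_unit pJ.
have -> : M *m col_mx x v =
    let y := invmx (1%:M + HR) *m (x - gR *: (HF *m x) - gR *: (L^T *m v)) in
    col_mx y (invmx (1%:M + HJ) *m (v - gJ *: (HG *m v)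
     + gJ *: (L *m ((1 + theta) *: y - theta *: x)))).
  rewrite /M /MPD mul_block_col /=; set WR := invmx _; set WJ := invmx _.
  congr col_mx.
    rewrite mulNmx -!scalemxAl -!mulmxA mulmxBl mul1mx -scalemxAl.
    by rewrite !mulmxBr -!scalemxAr.
  do 9!rewrite ?(mulmxDl, mulmxDr, mulmxN, mulNmx) -?(scalemxAl, scalemxAr)
    ?(mulmx1, mul1mx) -?mulmxA.
  by apply/matrixP => i j; rewrite !mxE; ring.
split=> [/eq_col_mx_inv[<- <-]|[<- E]] /=.
  by rewrite !mulKVmx.
by rewrite mulKmx// -E mulKmx.
Qed.

(** Weak form of the step, each row divided by its step size; the coupling then appears through L
    alone and cancels when the rows are added. *)
Lemma MPD_dot x v x' v' : M *m col_mx x v = col_mx x' v' -> forall y w,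
  gR^-1 * (dot y x' + dot y (HR *m x')) =
    gR^-1 * dot y x - dot y (HF *m x) - dot v (L *m y) /\
  gJ^-1 * (dot w v' + dot w (HJ *m v')) =
    gJ^-1 * dot w v - dot w (HG *m v)
    + ((1 + theta) * dot w (L *m x') - theta * dot w (L *m x)).
Proof.
move=> /MPD_mulE[Ex Ev] y w.
have := congr1 (dot y) Ex; have := congr1 (dot w) Ev.
rewrite !mulmxDl !mul1mx mulmxDr mulmxN -!scalemxAr !(dotDr, dotNr, dotZr).
rewrite [dot y (L^T *m v)]dot_mulmxr trmxK [dot (L *m y) v]dotC => -> ->.
by split; field; rewrite lt0r_neq0.
Qed.

(** Pair (x, v) with both rows of M (a, b). By symmetry every matrix in the rows moves onto x or v
    and vanishes, so the pairing is the one with (a, b). *)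
Lemma MPD_trmx_fixed x v : HR *m x = 0 -> HF *m x = 0 -> L *m x = 0 ->
  HJ *m v = 0 -> HG *m v = 0 -> L^T *m v = 0 ->
  M^T *m col_mx x v = col_mx x v.
Proof.
move=> Rx Fx Lx Jv Gv Lv; apply/subr0_eq/dot_eq0_all => w.
have [a [b ->]] := col_mxP w.
have [a' [b' E]] := col_mxP (M *m col_mx a b).
rewrite dotBl dot_mulmxl trmxK E !dot_col_mx; move/MPD_mulE: E => [Ea Eb].
have := congr1 (dot x) Ea; have := congr1 (dot v) Eb.
rewrite !mulmxDl !mul1mx !(dotDr, dotNr, dotZr) !(dot_mulmxr _ x) !(dot_mulmxr _ v).
rewrite pR.1 pJ.1 pF.1 pG.1 trmxK Rx Fx Lx Jv Gv Lv !dot0l.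
lra.
Qed.

Section ThetaOne.
Hypothesis th1 : theta = 1.
Context (bF bG ell : R).
Hypotheses (bF0 : 0 < bF) (bG0 : 0 < bG) (ell0 : 0 <= ell).
Hypothesis hF : forall x, dot x (HF *m x) <= bF^-1 * dot x x.
Hypothesis hG : forall v, dot v (HG *m v) <= bG^-1 * dot v v.
Hypothesis hL : forall x, norm2 (L *m x) <= ell * norm2 x.
Hypothesis hstep : 2 * Num.min bF bG * Num.min gJ^-1 gR^-1
                     * (1 - Num.sqrt (gJ * gR * ell ^+ 2)) > 1.

(* The metric [gR^-1, -L^T; -L, gJ^-1] dominates half of diag(HF, HG). *)
Lemma step_condition_lt x v : (x != 0) || (v != 0) ->
  dot x (HF *m x) + dot v (HG *m v) <
  2 * (gR^-1 * dot x x + gJ^-1 * dot v v - 2 * dot v (L *m x)).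
Proof.
move=> xv0; set b := Num.min bF bG; set u := Num.min gJ^-1 gR^-1.
set s := Num.sqrt (gJ * gR * ell ^+ 2).
have b0 : 0 < b by rewrite lt_min bF0.
have u0 : 0 < u by rewrite lt_min !invr_gt0 gJ0.
have s0 : 0 <= s by exact: sqrtr_ge0.
have s1 : 0 < 1 - s.
  have w0 : 0 < 2 * b * u by rewrite !mulr_gt0.
  by rewrite -(pmulr_rgt0 _ w0); exact: lt_trans ltr01 hstep.
have N0 : 0 < dot x x + dot v v.
  case/orP: xv0 => [/dot_gt0|/dot_gt0] h0.
    by have := dot_ge0 v; lra.
  by have := dot_ge0 x; lra.
have hFb : dot x (HF *m x) <= b^-1 * dot x x.
  apply: le_trans (hF x) _; rewrite ler_wpM2r ?dot_ge0// lef_pV2 ?posrE//.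
  by rewrite /b ge_min lexx.
have hGb : dot v (HG *m v) <= b^-1 * dot v v.
  apply: le_trans (hG v) _; rewrite ler_wpM2r ?dot_ge0// lef_pV2 ?posrE//.
  by rewrite /b ge_min lexx orbT.
have hux : u * dot x x <= gR^-1 * dot x x.
  by rewrite ler_wpM2r ?dot_ge0// /u ge_min lexx orbT.
have huv : u * dot v v <= gJ^-1 * dot v v.
  by rewrite ler_wpM2r ?dot_ge0// /u ge_min lexx.
have hb : b^-1 < 2 * u * (1 - s).
  by rewrite -(ltr_pM2l b0) mulfV ?lt0r_neq0//; move: hstep; rewrite -/b -/u -/s; lra.
(* Young's inequality for P |x| and Q |v|, where P^2 = 1/gR and Q^2 = 1/gJ, so that ell = s P Q. It
   leaves the fraction 1 - s of the diagonal part, which [hb] compares with 1/b. *)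
have hLs : 2 * dot v (L *m x) <= s * (gR^-1 * dot x x + gJ^-1 * dot v v).
  set P := Num.sqrt gR^-1; set Q := Num.sqrt gJ^-1.
  have P2 : P ^+ 2 = gR^-1 by rewrite sqr_sqrtr// invr_ge0 ltW.
  have Q2 : Q ^+ 2 = gJ^-1 by rewrite sqr_sqrtr// invr_ge0 ltW.
  have ellE : ell = s * P * Q.
    apply/eqP; rewrite -(@eqrXn2 _ 2) ?mulr_ge0 ?sqrtr_ge0// !exprMn P2 Q2.
    rewrite sqr_sqrtr ?mulr_ge0 ?sqr_ge0 ?(ltW gJ0) ?(ltW gR0)//.
    by apply/eqP; field; rewrite !lt0r_neq0.
  have hv : dot v (L *m x) <= norm2 v * (s * P * Q * norm2 x).
    rewrite (le_trans (dot_le_norm2 _ _))// ler_wpM2l ?norm2_ge0// -ellE.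
    exact: hL.
  rewrite -!sqr_norm2 -P2 -Q2.
  have := mulr_ge0 s0 (sqr_ge0 (P * norm2 x - Q * norm2 v)); lra.
have h1 : b^-1 * (dot x x + dot v v) < 2 * u * (1 - s) * (dot x x + dot v v).
  by rewrite ltr_pM2r.
have h2 : (1 - s) * (u * (dot x x + dot v v)) <=
    (1 - s) * (gR^-1 * dot x x + gJ^-1 * dot v v).
  by rewrite ler_pM2l// mulrDr lerD.
lra.
Qed.

Lemma step_condition_le x v :
  dot x (HF *m x) + dot v (HG *m v) <=
  2 * (gR^-1 * dot x x + gJ^-1 * dot v v - 2 * dot v (L *m x)).
Proof.
have [|] := boolP ((x != 0) || (v != 0)); first by move/step_condition_lt/ltW.
rewrite negb_or !negbK => /andP[/eqP-> /eqP->].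
by rewrite !mulmx0 !dot0r !mulr0 !addr0 subr0 mulr0.
Qed.

(** Tested against (x, v) itself, the coupling terms are -<v, L x> and +<v, L x>. The four
    nonnegative forms thus sum to 0 and each matrix kills its vector; testing against arbitrary
    vectors then leaves L x = 0 and L^T v = 0. *)
Lemma MPD1_fixed x v : M *m col_mx x v = col_mx x v ->
  [/\ HR *m x = 0, HF *m x = 0 & L *m x = 0] /\
  [/\ HJ *m v = 0, HG *m v = 0 & L^T *m v = 0].
Proof.
move=> E; have [] := MPD_dot E x v; rewrite th1 !mulrDr => e1 e2.
have iR : 0 < gR^-1 by rewrite invr_gt0.
have iJ : 0 < gJ^-1 by rewrite invr_gt0.
have r0 := mulr_ge0 (ltW iR) (pR.2 x); have j0 := mulr_ge0 (ltW iJ) (pJ.2 v).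
have f0 := pF.2 x; have g0 := pG.2 v.
have Rx : HR *m x = 0.
  by apply: sym_psd_ker => //; apply: (mulfI (lt0r_neq0 iR)); rewrite mulr0; lra.
have Jv : HJ *m v = 0.
  by apply: sym_psd_ker => //; apply: (mulfI (lt0r_neq0 iJ)); rewrite mulr0; lra.
have Fx : HF *m x = 0 by apply: sym_psd_ker => //; lra.
have Gv : HG *m v = 0 by apply: sym_psd_ker => //; lra.
split; split=> //; apply/dot_eq0_all => z.
  have := (MPD_dot E 0 z).2; rewrite Jv Gv !dot0r th1 => e.
  rewrite dotC; lra.
have := (MPD_dot E z 0).1; rewrite Rx Fx !dot0r => e.
rewrite dot_mulmxl trmxK; lra.
Qed.

(** With [nu] the squared V-norm of the eigenvector, [be] the form of the Riemannian Hessians, [c]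
    that of the smooth part and [s] the skew coupling, the pairing reads z (nu + be - i s) = nu - c.
    Here 0 <= c < 2 nu by the step size condition, so |nu - c| <= nu. *)
Lemma MPD1_cspectrum z : cspectrum M z -> z = 1 \/ Normc.normc z < 1.
Proof.
move=> /cspectrumP[z1 [z2 []]].
have [x1 [v1 ->]] := col_mxP z1; have [x2 [v2 ->]] := col_mxP z2.
case: z => a b /= nz E1 E2.
rewrite !scale_col_mx opp_col_mx add_col_mx in E1.
rewrite !scale_col_mx add_col_mx in E2.
have [X11 V11] := MPD_dot E1 x1 v1; have [X12 V12] := MPD_dot E1 x2 v2.
have [X21 V21] := MPD_dot E2 x1 v1; have [X22 V22] := MPD_dot E2 x2 v2.
move: X11 V11 X12 V12 X21 V21 X22 V22; rewrite th1.
rewrite !mulmxBr !mulmxDr -!scalemxAr !(dotBr, dotDr, dotZr).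
rewrite (dot_symC x2 x1 pR.1) (dot_symC x2 x1 pF.1).
rewrite (dot_symC v2 v1 pJ.1) (dot_symC v2 v1 pG.1) (dotC x2 x1) (dotC v2 v1).
move=> X11 V11 X12 V12 X21 V21 X22 V22.
have iR : 0 < gR^-1 by rewrite invr_gt0.
have iJ : 0 < gJ^-1 by rewrite invr_gt0.
pose nu := gR^-1 * (dot x1 x1 + dot x2 x2) + gJ^-1 * (dot v1 v1 + dot v2 v2)
  - 2 * (dot v1 (L *m x1) + dot v2 (L *m x2)).
pose be := gR^-1 * (dot x1 (HR *m x1) + dot x2 (HR *m x2))
  + gJ^-1 * (dot v1 (HJ *m v1) + dot v2 (HJ *m v2)).
pose c := dot x1 (HF *m x1) + dot x2 (HF *m x2)
  + dot v1 (HG *m v1) + dot v2 (HG *m v2).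
pose s := 2 * (dot v1 (L *m x2) - dot v2 (L *m x1)).
have be0 : 0 <= be by rewrite /be addr_ge0// mulr_ge0 ?(ltW iR) ?(ltW iJ)// addr_ge0// ?pR.2 ?pJ.2.
have c0 : 0 <= c by rewrite /c !addr_ge0 ?pF.2 ?pG.2.
have cnu : c < 2 * nu.
  have /orP[h|h] : ((x1 != 0) || (v1 != 0)) || ((x2 != 0) || (v2 != 0)).
    by move: nz; rewrite !col_mx_eq0 !negb_and.
  - have := step_condition_lt h; have := step_condition_le x2 v2.
    by rewrite /c /nu; lra.
  - have := step_condition_lt h; have := step_condition_le x1 v1.
    by rewrite /c /nu; lra.
have e1 : a * (nu + be) + b * s = nu - c by rewrite /nu /be /s /c; lra.
have e2 : a * s = b * (nu + be) by rewrite /nu /be /s; lra.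
have nu0 : 0 < nu by lra.
have [n1|n1] := ltP (a ^+ 2 + b ^+ 2) 1.
  right; rewrite -sqrtr1 ltr_sqrt//.
left; have key : (a ^+ 2 + b ^+ 2) * ((nu + be) ^+ 2 + s ^+ 2) = (nu - c) ^+ 2.
  transitivity ((a * (nu + be) + b * s) ^+ 2 + (a * s - b * (nu + be)) ^+ 2); first by ring.
  by rewrite e1 e2 subrr expr0n addr0.
have h1 : (nu + be) ^+ 2 + s ^+ 2 <= (nu - c) ^+ 2.
  by rewrite -key ler_peMl// addr_ge0 ?sqr_ge0.
(* Expanded, [h1] says 2 nu be + be^2 + s^2 + c (2 nu - c) <= 0, a sum of nonnegative terms. *)
have h2 : 0 <= c * (2 * nu - c) by rewrite mulr_ge0//; lra.
have h3 : 0 <= nu * be by rewrite mulr_ge0// ltW.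
have s2 := sqr_ge0 s; have be2 := sqr_ge0 be.
have s00 : s = 0 by apply/eqP; rewrite -sqrf_eq0; apply/eqP; lra.
have be00 : be = 0 by apply/eqP; rewrite -sqrf_eq0; apply/eqP; lra.
have /eqP : c * (2 * nu - c) = 0 by lra.
rewrite mulf_eq0 => /orP[/eqP c00|/eqP h]; last first.
  by move: cnu; rewrite -subr_gt0 h ltxx.
have a1 : a = 1 by apply: (mulIf (lt0r_neq0 nu0)); move: e1; rewrite be00 s00 c00; lra.
have b0 : b = 0 by apply: (mulIf (lt0r_neq0 nu0)); move: e2; rewrite be00 s00; lra.
by rewrite a1 b0.
Qed.

Lemma MPD1_trmx_fixed (z : 'cV[R]_(n + m)) : M *m z = z -> M^T *m z = z.
Proof.
have [x [v ->]] := col_mxP z => /MPD1_fixed[[Rx Fx Lx] [Jv Gv Lv]].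
exact: MPD_trmx_fixed.
Qed.

End ThetaOne.
End PrimalDualMatrix.

(* For F = G^* = 0 and vanishing Riemannian Hessians, both resolvents are the
   identity. *)
Section PolyhedralCase.
Context (R : realType) (n m : nat).
Context (gR gJ theta : R) (L : 'M[R]_(m, n)) (ell : R).
Implicit Types (x : 'cV[R]_n) (v : 'cV[R]_m).
Let M := MPD gR gJ theta (invmx (1%:M + 0)) 0 (invmx (1%:M + 0)) 0 L.
Hypotheses (gR0 : 0 < gR) (gJ0 : 0 < gJ) (th0 : 0 < theta) (th1 : theta <= 1).
Hypothesis ell0 : 0 <= ell.
Hypothesis hL : forall x, norm2 (L *m x) <= ell * norm2 x.
Hypothesis hstep : gJ * gR * ell ^+ 2 < 1.
Let g := gJ * gR.

Lemma polyhedral_step_lt v : v != 0 -> g * dot (L^T *m v) (L^T *m v) < dot v v.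
Proof.
move=> /dot_gt0 v0.
have h : dot (L^T *m v) (L^T *m v) <= ell ^+ 2 * dot v v.
  rewrite -!sqr_norm2 -exprMn lerXn2r ?nnegrE ?mulr_ge0 ?norm2_ge0//.
  exact: norm2_trmx_mulmx_le.
apply: (@le_lt_trans _ _ (g * (ell ^+ 2 * dot v v))).
  by rewrite ler_pM2l// /g mulr_gt0.
by rewrite mulrA gtr_pMl.
Qed.

(** In the variable X - 1 the quadratic is Y^2 + (1 + theta) k Y + k. This bound with k < 1 makes
    its discriminant negative. *)
Lemma relaxation_sqr_le1 : (1 + theta) ^+ 2 / 4 <= 1.
Proof. by move: th0 th1; nra. Qed.

Lemma polyhedral_mulE x v x' v' : M *m col_mx x v = col_mx x' v' <->
  x' = x - gR *: (L^T *m v) /\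
  v' = v + gJ *: (L *m ((1 + theta) *: x' - theta *: x)).
Proof.
have := @MPD_mulE R n m gR gJ theta 0 0 0 0 L (sym_psd0 R n) (sym_psd0 R m) x v x' v'.
by rewrite -/M !addr0 !mul1mx !mul0mx !scaler0 !subr0.
Qed.

Lemma polyhedral_fixedE x v :
  M *m col_mx x v = col_mx x v <-> L *m x = 0 /\ L^T *m v = 0.
Proof.
rewrite polyhedral_mulE; rewrite -scalerBl addrK scale1r.
split=> [[Ex Ev]|[-> ->]]; last by rewrite !scaler0 subr0 addr0.
split.
  apply: (scalerI (lt0r_neq0 gJ0)); rewrite scaler0; apply: (addrI v).
  by rewrite -Ev addr0.
apply: (scalerI (lt0r_neq0 gR0)); rewrite scaler0; apply/oppr_inj/(addrI x).
by rewrite -Ex oppr0 addr0.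
Qed.

Lemma polyhedral_trmx_fixed (z : 'cV[R]_(n + m)) : M *m z = z -> M^T *m z = z.
Proof.
have [x [v ->]] := col_mxP z => /polyhedral_fixedE[Lx Lv].
by apply: MPD_trmx_fixed; rewrite ?mul0mx//; exact: sym_psd0.
Qed.

(** Eliminating x and pairing with v gives mu^2 V + ((1 + theta) mu + 1) T = 0 for mu = a - 1, which
    has no real solution when 0 < T < V. So T = 0, hence mu = 0, and only fixed points remain. *)
Lemma polyhedral_real_eigen (a : R) x v :
  M *m col_mx x v = a *: col_mx x v ->
  (x = 0 /\ v = 0) \/ (L *m x = 0 /\ L^T *m v = 0).
Proof.
rewrite scale_col_mx => /polyhedral_mulE[Ex Ev]; set mu := a - 1.
have Ex' : mu *: x = - gR *: (L^T *m v).
  by rewrite scalerBl scale1r Ex addrC addKr scaleNr.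
have Ev' : mu *: v = (gJ * ((1 + theta) * mu + 1)) *: (L *m x).
  rewrite scalerBl scale1r Ev addrC addKr scalerA -scalerBl -scalemxAr scalerA.
  by congr (_ *: _); rewrite /mu; ring.
set V := dot v v; set T := g * dot (L^T *m v) (L^T *m v).
have T0 : 0 <= T by rewrite mulr_ge0 ?dot_ge0// /g mulr_ge0// ltW.
have quad : mu ^+ 2 * V + ((1 + theta) * mu + 1) * T = 0.
  have := congr1 (dot v) Ev'; have := congr1 (dot (L^T *m v)) Ex'.
  rewrite !dotZr (dot_mulmxr L v x) -/V => h1 h2.
  by rewrite expr2 -mulrA h2 -mulrA [_ * dot _ x]mulrC; rewrite /T /g;
    transitivity (gJ * ((1 + theta) * mu + 1) * (mu * dot (L^T *m v) x +
      gR * dot (L^T *m v) (L^T *m v))); [ring|rewrite h1; ring].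
have [v0|v0] := eqVneq v 0.
  have [mu0|mu0] := eqVneq mu 0.
    right; split; last by rewrite v0 mulmx0.
    move: Ev'; rewrite v0 scaler0 mu0 mulr0 add0r mulr1 => /esym/eqP.
    by rewrite scaler_eq0 (gt_eqF gJ0) => /eqP.
  left; split=> //; apply/eqP; move/eqP: Ex'.
  by rewrite v0 mulmx0 scaler0 scaler_eq0 (negbTE mu0).
have TV : T < V by exact: polyhedral_step_lt.
have V0 : 0 < V by exact: dot_gt0.
(* Completed square of V times the quadratic; its second term is positive unless T = 0. *)
have e : (mu * V + (1 + theta) * T / 2) ^+ 2 + T * (V - (1 + theta) ^+ 2 / 4 * T) = 0.
  by transitivity (V * (mu ^+ 2 * V + ((1 + theta) * mu + 1) * T));
    [field|rewrite quad mulr0].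
have [T00|T00] := eqVneq T 0; last first.
  have Tp : 0 < T by rewrite lt_neqAle eq_sym T00.
  have th4 : (1 + theta) ^+ 2 / 4 * T <= T.
    by rewrite ger_pMl// relaxation_sqr_le1.
  have tp : 0 < T * (V - (1 + theta) ^+ 2 / 4 * T) by rewrite mulr_gt0//; lra.
  have := ltr_wpDl (sqr_ge0 (mu * V + (1 + theta) * T / 2)) tp.
  by rewrite e ltxx.
have Lv : L^T *m v = 0.
  move/eqP: T00; rewrite mulf_eq0 dot_eq0 /g mulf_eq0 !gt_eqF//=.
  by move/eqP.
have mu0 : mu = 0.
  move/eqP: quad; rewrite T00 mulr0 addr0 mulf_eq0 (gt_eqF V0) orbF sqrf_eq0.
  by move/eqP.
right; split=> //; move: Ev'; rewrite mu0 scale0r mulr0 add0r mulr1 => /esym/eqP.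
by rewrite scaler_eq0 (gt_eqF gJ0) => /eqP.
Qed.

(** Write p + i b for the eigenvalue minus 1. Eliminating x gives (p + i b)^2 v = - g (c + i d) L
    L^T v with c + i d = 1 + (1 + theta)(p + i b). Pairing with v determines p and b from the
    Rayleigh quotient k = T / V, and then v must be an eigenvector of g L L^T for k. *)
Lemma polyhedral_nonreal_eigen (a b : R) x1 v1 x2 v2 :
  (col_mx x1 v1 != 0) || (col_mx x2 v2 != 0) -> b != 0 ->
  M *m col_mx x1 v1 = a *: col_mx x1 v1 - b *: col_mx x2 v2 ->
  M *m col_mx x2 v2 = b *: col_mx x1 v1 + a *: col_mx x2 v2 ->
  exists (k : R) (w : 'cV[R]_m), [/\ 0 < k, w != 0,
    g *: (L *m (L^T *m w)) = k *: w & a ^+ 2 + b ^+ 2 = 1 - theta * k].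
Proof.
move=> nz b0; rewrite !scale_col_mx opp_col_mx !add_col_mx.
move=> /polyhedral_mulE[X1 V1] /polyhedral_mulE[X2 V2].
set p := a - 1; set c := 1 + (1 + theta) * p; set d := (1 + theta) * b.
set y1 := L *m x1; set y2 := L *m x2.
set u1 := L *m (L^T *m v1); set u2 := L *m (L^T *m v2).
have Y1 : p *: y1 - b *: y2 = - gR *: u1.
  have := congr1 (mulmx L) X1.
  rewrite !mulmxBr -!scalemxAr -/y1 -/y2 -/u1 => h.
  by rewrite scalerBl scale1r addrAC h addrC addKr scaleNr.
have Y2 : b *: y1 + p *: y2 = - gR *: u2.
  have := congr1 (mulmx L) X2.
  rewrite mulmxBr mulmxDr -!scalemxAr -/y1 -/y2 -/u2 => h.
  by rewrite scalerBl scale1r addrA h addrC addKr scaleNr.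
have W1 : p *: v1 - b *: v2 = gJ *: (c *: y1 - d *: y2).
  rewrite scalerBl scale1r addrAC V1 addrC addKr; congr (gJ *: _).
  rewrite mulmxBr -!scalemxAr mulmxBr -!scalemxAr -/y1 -/y2.
  by apply/matrixP => i j; rewrite !mxE /c /d /p; ring.
have W2 : b *: v1 + p *: v2 = gJ *: (d *: y1 + c *: y2).
  rewrite scalerBl scale1r addrA V2 addrC addKr; congr (gJ *: _).
  rewrite mulmxBr -!scalemxAr mulmxDr -!scalemxAr -/y1 -/y2.
  by apply/matrixP => i j; rewrite !mxE /c /d /p; ring.
have A1 : (p ^+ 2 - b ^+ 2) *: v1 - (2 * p * b) *: v2 = - g *: (c *: u1 - d *: u2).
  transitivity (p *: (p *: v1 - b *: v2) - b *: (b *: v1 + p *: v2)).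
    by apply/matrixP => i j; rewrite !mxE; ring.
  rewrite W1 W2; transitivity (gJ *: (c *: (p *: y1 - b *: y2) - d *: (b *: y1 + p *: y2))).
    by apply/matrixP => i j; rewrite !mxE; ring.
  by rewrite Y1 Y2; apply/matrixP => i j; rewrite !mxE /g; ring.
have A2 : (2 * p * b) *: v1 + (p ^+ 2 - b ^+ 2) *: v2 = - g *: (d *: u1 + c *: u2).
  transitivity (p *: (b *: v1 + p *: v2) + b *: (p *: v1 - b *: v2)).
    by apply/matrixP => i j; rewrite !mxE; ring.
  rewrite W1 W2; transitivity (gJ *: (d *: (p *: y1 - b *: y2) + c *: (b *: y1 + p *: y2))).
    by apply/matrixP => i j; rewrite !mxE; ring.
  by rewrite Y1 Y2; apply/matrixP => i j; rewrite !mxE /g; ring.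
have du v v' : dot v (L *m (L^T *m v')) = dot (L^T *m v) (L^T *m v').
  by rewrite dot_mulmxr.
set V := dot v1 v1 + dot v2 v2.
set T := g * (dot (L^T *m v1) (L^T *m v1) + dot (L^T *m v2) (L^T *m v2)).
(* If v vanished, the primal row would give (p + i b) x = 0, hence x = 0 as b is non-zero. *)
have vn : (v1 != 0) || (v2 != 0).
  apply: contraT; rewrite negb_or !negbK => /andP[/eqP v10 /eqP v20].
  have x10 : (p ^+ 2 + b ^+ 2) *: x1 = 0.
    transitivity (p *: ((a *: x1 - b *: x2) - x1) + b *: ((b *: x1 + a *: x2) - x2)).
      by apply/matrixP => i j; rewrite !mxE /p; ring.
    by rewrite X1 X2 v10 v20 !mulmx0 !scaler0 !subr0 !subrr !scaler0 addr0.
  have x20 : (p ^+ 2 + b ^+ 2) *: x2 = 0.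
    transitivity (p *: ((b *: x1 + a *: x2) - x2) - b *: ((a *: x1 - b *: x2) - x1)).
      by apply/matrixP => i j; rewrite !mxE /p; ring.
    by rewrite X1 X2 v10 v20 !mulmx0 !scaler0 !subr0 !subrr !scaler0 subr0.
  have pb : p ^+ 2 + b ^+ 2 != 0.
    by rewrite paddr_eq0 ?sqr_ge0// !sqrf_eq0 negb_and b0 orbT.
  move/eqP: x10; rewrite scaler_eq0 (negbTE pb) => /eqP x10.
  move/eqP: x20; rewrite scaler_eq0 (negbTE pb) => /eqP x20.
  by move: nz; rewrite x10 x20 v10 v20 col_mx0 eqxx.
have V0 : 0 < V.
  case/orP: vn => /dot_gt0 h; rewrite /V.
    by have := dot_ge0 v2; lra.
  by have := dot_ge0 v1; lra.
have T0 : 0 <= T by rewrite mulr_ge0 ?addr_ge0 ?dot_ge0// /g mulr_ge0// ltW.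
have e1 : (p ^+ 2 - b ^+ 2) * V = - c * T.
  have := congr1 (dot v1) A1; have := congr1 (dot v2) A2.
  rewrite !(dotDr, dotNr, dotZr) !du (dotC v2 v1) (dotC (L^T *m v2) (L^T *m v1)).
  by rewrite /V /T; lra.
have e2 : 2 * p * b * V = - d * T.
  have := congr1 (dot v2) A1; have := congr1 (dot v1) A2.
  rewrite !(dotDr, dotNr, dotZr) !du (dotC v2 v1) (dotC (L^T *m v2) (L^T *m v1)).
  by rewrite /V /T; lra.
(* Since d = (1 + theta) b, the imaginary part can be divided by b. *)
have e3 : 2 * p * V = - (1 + theta) * T.
  by apply: (mulIf b0); move: e2; rewrite /d; lra.
have e4 : (p ^+ 2 + b ^+ 2) * V = T.
  have : p * (2 * p * V) = p * (- (1 + theta) * T) by rewrite e3.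
  by move: e1; rewrite /c; lra.
have b2 : 0 < b ^+ 2 by rewrite lt_neqAle eq_sym sqrf_eq0 b0 sqr_ge0.
have Tp : 0 < T by rewrite -e4 mulr_gt0//; have := sqr_ge0 p; lra.
pose k := T / V; have kV : k * V = T by rewrite divfK// lt0r_neq0.
have k0 : 0 < k by rewrite divr_gt0.
have kE : k = p ^+ 2 + b ^+ 2 by apply: (mulIf (lt0r_neq0 V0)); rewrite kV e4.
have pk : 2 * p = - (1 + theta) * k.
  by apply: (mulIf (lt0r_neq0 V0)); rewrite e3 -mulrA kV.
have d0 : d != 0 by rewrite mulf_neq0// lt0r_neq0// addr_gt0.
have cd : c ^+ 2 + d ^+ 2 != 0.
  by rewrite paddr_eq0 ?sqr_ge0// !sqrf_eq0 (negbTE d0) andbF.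
have rc : p ^+ 2 - b ^+ 2 = - c * k.
  rewrite /c mulNr mulrDl mul1r [(1 + theta) * p]mulrC -mulrA.
  have -> : (1 + theta) * k = - (2 * p) by rewrite pk; ring.
  by rewrite kE; ring.
have rd : 2 * p * b = - d * k by rewrite pk /d; ring.
(* Residuals of the eigenvector equation. The two identities below say that c + i d times r1 + i r2
   is 0, and c + i d is non-zero. *)
pose r1 := g *: u1 - k *: v1; pose r2 := g *: u2 - k *: v2.
have B1 : c *: r1 - d *: r2 = 0.
  transitivity (g *: (c *: u1 - d *: u2) + ((- c * k) *: v1 - (- d * k) *: v2)).
    by apply/matrixP => i j; rewrite !mxE; ring.
  by rewrite -rc -rd A1 scaleNr subrr.
have B2 : d *: r1 + c *: r2 = 0.
  transitivity (g *: (d *: u1 + c *: u2) + ((- d * k) *: v1 + (- c * k) *: v2)).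
    by apply/matrixP => i j; rewrite !mxE; ring.
  by rewrite -rc -rd A2 scaleNr subrr.
have R1 : r1 = 0.
  apply: (scalerI cd); rewrite scaler0.
  transitivity (c *: (c *: r1 - d *: r2) + d *: (d *: r1 + c *: r2)).
    by apply/matrixP => i j; rewrite !mxE; ring.
  by rewrite B1 B2 !scaler0 addr0.
have R2 : r2 = 0.
  apply: (scalerI cd); rewrite scaler0.
  transitivity (c *: (d *: r1 + c *: r2) - d *: (c *: r1 - d *: r2)).
    by apply/matrixP => i j; rewrite !mxE; ring.
  by rewrite B1 B2 !scaler0 subr0.
have ab : a ^+ 2 + b ^+ 2 = 1 - theta * k.
  have -> : a = p + 1 by rewrite /p subrK.
  by move: pk kE; lra.
case/orP: vn => vn0.
  by exists k, v1; split=> //; apply/eqP; rewrite -subr_eq0 -/u1 -/r1 R1.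
by exists k, v2; split=> //; apply/eqP; rewrite -subr_eq0 -/u2 -/r2 R2.
Qed.

Section Projection.
Context (P : 'M[R]_(n + m)).
Hypothesis hP : is_orth_proj P [set z : 'cV[R]_(n + m) | M *m z = z].
Let N := M - P.

(** If z were real, both parts of the eigenvector would be real eigenvectors of M, hence fixed
    points or 0; being killed by P, both would vanish. *)
Lemma polyhedral_cspectrum_nonreal z : cspectrum N z -> z != 0 ->
  complex.Im z != 0 /\
  exists (k : R) (w : 'cV[R]_m), [/\ 0 < k, w != 0,
    g *: (L *m (L^T *m w)) = k *: w
    & Normc.normc z = Num.sqrt (1 - theta * k)].
Proof.
move=> Nz z0.
have [z1 [z2 [nz P1 P2]]] := cspectrum_sub_proj hP polyhedral_trmx_fixed Nz z0.
have [x1 [v1 E1]] := col_mxP z1; have [x2 [v2 E2]] := col_mxP z2.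
case: z z0 {Nz} => a b z0 /= M1 M2.
have b0 : b != 0.
  apply/eqP => b0; move: M1 M2; rewrite b0 !scale0r subr0 add0r => M1 M2.
  have kill x v (z : 'cV_(n + m)) : z = col_mx x v -> P *m z = 0 -> M *m z = a *: z -> z = 0.
    move=> -> Pz /polyhedral_real_eigen[[-> ->]|/polyhedral_fixedE h].
      by rewrite col_mx0.
    by rewrite -Pz; symmetry; exact: (fixed_proj_id hP).
  by move: nz; rewrite (kill _ _ _ E1 P1 M1) (kill _ _ _ E2 P2 M2) eqxx.
split=> //; rewrite E1 E2 in nz M1 M2.
have [k [w [k0 w0 kw ab]]] := polyhedral_nonreal_eigen nz b0 M1 M2.
by exists k, w; split=> //; rewrite ab.
Qed.

(** For z in the kernel of N, w = z - P z satisfies M w = 0 and P w = 0. As a real eigenvector for 0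
    it must vanish, so z is a fixed point. *)
Lemma polyhedral_cspectrum0 : cspectrum N 0 ->
  exists x v, [/\ (x != 0) || (v != 0), L *m x = 0 & L^T *m v = 0].
Proof.
move=> /cspectrumP[z1 [z2 [nz /=]]]; rewrite !scale0r subr0 addr0 => N1 N2.
have kill (z : 'cV_(n + m)) : N *m z = 0 -> M *m z = z.
  move=> Nz; set w := z - P *m z.
  have Mz : M *m z = P *m z by apply/subr0_eq; rewrite -mulmxBl.
  have Mw : M *m w = 0 *: w.
    by rewrite mulmxBr mulmxA (mulmx_fixed_proj hP) Mz subrr scale0r.
  have Pw : P *m w = 0.
    by rewrite mulmxBr mulmxA (fixed_proj_idem hP) subrr.
  have w0 : w = 0.
    have [x [v E]] := col_mxP w; rewrite E in Mw Pw *.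
    have [[-> ->]|/polyhedral_fixedE h] := polyhedral_real_eigen Mw.
      by rewrite col_mx0.
    by rewrite -Pw; symmetry; exact: (fixed_proj_id hP).
  by rewrite Mz; apply/esym/subr0_eq.
case/orP: nz => z0; [move: z0 (kill _ N1)|move: z0 (kill _ N2)].
  have [x [v ->]] := col_mxP z1; rewrite col_mx_eq0 negb_and.
  by move=> nz /polyhedral_fixedE[]; exists x, v.
have [x [v ->]] := col_mxP z2; rewrite col_mx_eq0 negb_and.
by move=> nz /polyhedral_fixedE[]; exists x, v.
Qed.

(* The eigenvector belongs to the root 1 + p + i q of the quadratic
   polynomial attached to k = gR gJ s. *)
Lemma polyhedral_cspectrum_of_singular (s : R) (w : 'cV[R]_m) : 0 < s ->
  w != 0 -> L *m (L^T *m w) = s *: w ->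
  exists2 z, cspectrum N z & Normc.normc z = Num.sqrt (1 - theta * (g * s)).
Proof.
move=> s0 w0 Lw; set k := g * s.
have g0 : 0 < g by rewrite mulr_gt0.
have k0 : 0 < k by rewrite mulr_gt0.
have k1 : k < 1.
  rewrite -(ltr_pM2r (dot_gt0 w0)) mul1r -mulrA -dotZr -Lw dot_mulmxr.
  exact: polyhedral_step_lt.
set p := - ((1 + theta) * k / 2); set q := Num.sqrt (k - p ^+ 2).
have q2 : q ^+ 2 = k - p ^+ 2.
  rewrite sqr_sqrtr//; have : k ^+ 2 <= k by rewrite expr2 ger_pMl// ltW.
  have -> : p ^+ 2 = (1 + theta) ^+ 2 / 4 * k ^+ 2 by rewrite /p; field.
  by move=> h; have := ler_wpM2r (sqr_ge0 k) relaxation_sqr_le1; lra.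
set t := L^T *m w; have tw : L *m t = s *: w by [].
(* The primal row forces x = - gR (p + i q)^-1 L^T w; here (p + i q)^-1 = (p - i q) / k because p^2
   + q^2 = k. *)
pose z1 := col_mx (- (gR * p / k) *: t) w.
pose z2 := col_mx ((gR * q / k) *: t) (0 : 'cV[R]_m).
have gk : gR * s / k = gJ^-1.
  by rewrite /k /g; field; rewrite !lt0r_neq0.
have M1 : M *m z1 = (1 + p) *: z1 - q *: z2.
  rewrite /z1 /z2 !scale_col_mx opp_col_mx add_col_mx; apply/polyhedral_mulE.
  split.
    rewrite -/t; move: (t) => u; apply/matrixP => i j; rewrite !mxE.
    transitivity (- (gR * p / k) * u i j - gR * (p ^+ 2 + q ^+ 2) / k * u i j); first by ring.
    by rewrite q2 [_ + (k - _)]addrC subrK mulfK ?lt0r_neq0.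
  rewrite !(mulmxBr, mulmxDr) -!scalemxAr tw !mulmxBr -!scalemxAr tw.
  apply/matrixP => i j; rewrite !mxE.
  transitivity (w i j + gJ * (gR * s / k) * w i j *
    (- (1 + (1 + theta) * p) * p - (1 + theta) * q ^+ 2)); last by ring.
  by rewrite gk mulfV ?lt0r_neq0// q2 /p; field.
have M2 : M *m z2 = q *: z1 + (1 + p) *: z2.
  rewrite /z1 /z2 !scale_col_mx add_col_mx; apply/polyhedral_mulE.
  split.
    rewrite -/t; move: (t) => u; apply/matrixP => i j.
    by rewrite mulmx0 !mxE; ring.
  rewrite !(mulmxBr, mulmxDr) -!scalemxAr tw !mulmxDr -!scalemxAr tw.
  apply/matrixP => i j; rewrite !mxE.
  transitivity (gJ * (gR * s / k) * q * w i j); last by ring.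
  by rewrite gk mulfV ?lt0r_neq0// mul1r; ring.
(* These vectors are orthogonal to ker L x ker L^T, which is the fixed set. *)
have Pz (y : 'cV[R]_n) (u : 'cV[R]_m) : P *m col_mx (L^T *m u) (L *m y) = 0.
  have [sP iP] := is_orth_proj_projector hP.
  apply/eqP; rewrite -dot_eq0 dot_mulmxl sP mulmxA iP.
  have [x [v E]] := col_mxP (P *m col_mx (L^T *m u) (L *m y)).
  have := (hP (col_mx (L^T *m u) (L *m y))).1.
  rewrite /= E => /polyhedral_fixedE[Lx Lv].
  by rewrite dot_col_mx !dot_mulmxl trmxK Lx Lv !dot0r addr0.
have P1 : P *m z1 = 0.
  have -> : z1 = col_mx (L^T *m (- (gR * p / k) *: w)) (L *m (s^-1 *: t)).
    by rewrite -!scalemxAr tw scalerA mulVf ?lt0r_neq0// scale1r.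
  exact: Pz.
have P2 : P *m z2 = 0.
  have -> : z2 = col_mx (L^T *m ((gR * q / k) *: w)) (L *m 0).
    by rewrite -!scalemxAr mulmx0.
  exact: Pz.
exists (Complex (1 + p) q); last first.
  rewrite normcE_complex; congr Num.sqrt; rewrite q2 /p; by field.
apply/cspectrumP; exists z1, z2; split; rewrite /= /N.
- by rewrite /z1 col_mx_eq0 negb_and w0 orbT.
- by rewrite mulmxBl M1 P1 subr0.
- by rewrite mulmxBl M2 P2 subr0.
Qed.

End Projection.
End PolyhedralCase.

(** * Singular values *)

Section SingularValues.
Context (R : realType).

Lemma eigenvalue_cVP n (A : 'M[R]_n) a :
  eigenvalue A a <-> exists2 x : 'cV[R]_n, x != 0 & A *m x = a *: x.
Proof.
rewrite -eigenvalue_trmx; split=> [/eigenvalueP[v Av v0]|[x x0 Ax]].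
  exists v^T; last by apply: trmx_inj; rewrite trmx_mul trmxK linearZ/= trmxK.
  by apply: contraNneq v0 => /(congr1 trmx); rewrite trmxK trmx0 => ->.
apply/eigenvalueP; exists x^T; first by rewrite -trmx_mul Ax linearZ.
by apply: contraNneq x0 => /(congr1 trmx); rewrite trmxK trmx0 => ->.
Qed.

(** Starting from B Q instead of Q keeps the eigenvectors found inside the range of B; the first
    factor that kills the current matrix provides the eigenvalue. *)
Lemma foldl_eigen n (B : 'M[R[i]]_n) (rs : seq R[i]) (Q : 'M[R[i]]_n) :
  foldl (fun Q z => (B - z%:M) *m Q) (B *m Q) rs = 0 -> B *m Q != 0 ->
  exists z (Q' : 'M[R[i]]_n), B *m Q' != 0 /\ B *m (B *m Q') = z *: (B *m Q').
Proof.
elim: rs Q => [|z rs IH] Q /=; first by move=> ->; rewrite eqxx.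
have -> : (B - z%:M) *m (B *m Q) = B *m ((B - z%:M) *m Q).
  by rewrite !mulmxBl mulmxBr !mul_scalar_mx scalemxAr.
have [BQ _ BQ0|BQ h _] := eqVneq (B *m ((B - z%:M) *m Q)) 0; last exact: IH h BQ.
exists z, Q; split=> //; apply/eqP; rewrite -subr_eq0.
by move: BQ; rewrite mulmxBl mulmxBr mul_scalar_mx scalemxAr => ->.
Qed.

(** The eigenvector is taken in the range of B. Eigenvalue 0 would mean B B w = 0, hence B w = 0 by
    symmetry, a contradiction. *)
Lemma sym_nonzero_eigen n (B : 'M[R]_n) : B^T = B -> B != 0 ->
  exists2 a, a != 0 & exists2 x : 'cV[R]_n, x != 0 & B *m x = a *: x.
Proof.
case: n B => [|n] B sB B0.
  by case/eqP: B0; apply/matrixP => -[].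
set BC := map_mx (real_complex R) B.
have BC0 : BC != 0 by rewrite map_mx_eq0.
have [rs E] := char_poly_split BC.
have [||z [Q [Q0 QE]]] := @foldl_eigen _ BC rs 1%:M; rewrite ?mulmx1//.
  by rewrite foldl_horner_mx -E Cayley_Hamilton mul0mx.
have [j j0] : exists j, col j (BC *m Q) != 0.
  apply: contrapT => /forallNP h; case/eqP: Q0; apply/matrixP => i j.
  have /negP := h j; rewrite negbK => /eqP/matrixP/(_ i ord0).
  by rewrite !mxE.
set u := col j Q; have uE : col j (BC *m Q) = BC *m u by rewrite /u !colE mulmxA.
rewrite uE in j0; have Bu : BC *m (BC *m u) = z *: (BC *m u).
  by rewrite -uE !colE mulmxA QE -scalemxAl.
move: j0 Bu; rewrite (cplx_mx_Re_Im u) !mulmx_cplx.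
set x := map_mx _ u; set y := map_mx _ u; case: z {QE} => a b.
rewrite scale_cplx => nz /cplx_mx_inj[Bx By].
have {}nz : (B *m x != 0) || (B *m y != 0).
  apply: contraNT nz; rewrite negb_or !negbK => /andP[/eqP-> /eqP->].
  by rewrite /cplx_mx map_mx0 scaler0 addr0.
set X := B *m x in Bx By nz *; set Y := B *m y in Bx By nz *.
(* Symmetry of B, tested on the real and imaginary parts, gives b (|X|^2 + |Y|^2) = 0. *)
have b0 : b = 0.
  have := dot_symC X Y sB; rewrite Bx By !(dotDr, dotNr, dotZr) (dotC Y X) => h.
  have : b * (dot X X + dot Y Y) = 0 by lra.
  move=> /eqP; rewrite mulf_eq0 paddr_eq0 ?dot_ge0// !dot_eq0 => /orP[/eqP//|].
  by move: nz; case: eqVneq => //= _; case: eqVneq.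
move: Bx By; rewrite b0 !scale0r subr0 add0r => Bx By.
have a0 : a != 0.
  apply/eqP => a0; move: Bx By; rewrite a0 !scale0r => Bx By.
  have sq (w : 'cV[R]_n.+1) : B *m (B *m w) = 0 -> B *m w = 0.
    move=> h; apply/eqP; rewrite -dot_eq0 dot_mulmxl sB; apply/eqP.
    by rewrite h dot0r.
  by move: nz; rewrite /X /Y (sq _ Bx) (sq _ By) eqxx.
by exists a => //; case/orP: nz => h; [exists X|exists Y].
Qed.

Lemma inf_mem_finite (S : set R) (s : seq R) : S !=set0 ->
  (forall x, S x -> x \in s) -> S (inf S).
Proof.
move=> S0 Ss.
have [m Sm hm] : exists2 m, S m & forall x, S x -> m <= x.
  have [x0 Sx0] := S0.
  suff [m Sm hm] : exists2 m, S m & forall x, x \in s -> S x -> m <= x.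
    by exists m => // x Sx; apply: hm => //; exact: Ss.
  elim: s {Ss} => [|y s [m Sm hm]]; first by exists x0.
  have [[Sy ym]|h] := pselect (S y /\ y <= m).
    exists y => // x; rewrite inE => /predU1P[->//|xs Sx].
    exact: le_trans ym (hm _ xs Sx).
  exists m => // x; rewrite inE => /predU1P[-> Sy|]; last exact: hm.
  by rewrite leNgt; apply/negP => /ltW ym; apply: h.
suff -> : inf S = m by [].
apply/eqP; rewrite eq_le; apply/andP; split; first by apply: ge_inf => //; exists m.
by apply: lb_le_inf => // x /hm.
Qed.

Lemma sigma_min_le m n (A : 'M[R]_(m, n)) s :
  singular_value A s -> s != 0 -> sigma_min A <= s.
Proof.
by move=> sA s0; apply: ge_inf; [exists 0 => ? [[]]|split].
Qed.

(** The infimum is attained because the singular values are roots of the finitely many eigenvalues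
    of A^T A; a non-zero one exists since A^T A is non-zero and symmetric. *)
Lemma sigma_minP m n (A : 'M[R]_(m, n)) : (0 < \rank A)%N ->
  singular_value A (sigma_min A) /\ sigma_min A != 0.
Proof.
move=> rA; have [rs rsE] := cspectrum_finite (A^T *m A).
apply: (@inf_mem_finite [set s | singular_value A s /\ s != 0]
  [seq Num.sqrt (complex.Re z) | z <- rs]).
  have [||a a0 [x x0 Bx]] := @sym_nonzero_eigen _ (A^T *m A).
  - by rewrite trmx_mul trmxK.
  - apply: contraTneq rA => h; rewrite lt0n negbK mxrank_eq0; apply/eqP.
    apply: mulmx_cV_inj => x; rewrite mul0mx; apply/eqP.
    by rewrite -dot_eq0 dot_mulmxl mulmxA h mul0mx dot0r.
  have xx := dot_gt0 x0.
  have a_ge0 : 0 <= a.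
    rewrite -(pmulr_lge0 _ xx) -dotZr -Bx -mulmxA dot_mulmxr trmxK.
    exact: dot_ge0.
  exists (Num.sqrt a); split; last by rewrite sqrtr_eq0 -ltNge lt_neqAle eq_sym a0.
  split; first exact: sqrtr_ge0.
  by rewrite sqr_sqrtr//; apply/eigenvalue_cVP; exists x.
move=> s [[s0 /eigenvalue_cVP[x x0 Bx]] _]; apply/mapP; exists ((s ^+ 2)%:C)%C.
  apply/rsE/cspectrumP; exists x, 0; split; rewrite ?x0//=.
    by rewrite scaler0 subr0.
  by rewrite mulmx0 scale0r scaler0 addr0.
by rewrite /= sqrtr_sqr ger0_norm.
Qed.

Lemma is_svd_tr m n (A : 'M[R]_(m, n)) X S Y :
  is_svd A X S Y -> is_svd A^T Y S^T X.
Proof.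
move=> [XX YY -> hS]; split=> //; first by rewrite !trmx_mul trmxK mulmxA.
move=> i j; have [h1 h2 h3] := hS j i; rewrite mxE mxrank_tr.
split=> [ij|ij li|ij li].
- by apply: h1; rewrite eq_sym.
- by apply: h2 => //; rewrite -ij.
- by apply: h3 => //; rewrite -ij.
Qed.

(** In the coordinates Y^T z, the kernel of A is the set where the first l coordinates vanish, the
    corresponding diagonal entries of S being positive and the others 0. *)
Lemma is_svd_proj m n (A : 'M[R]_(m, n)) X S Y : is_svd A X S Y ->
  is_orth_proj (Y *m copid_mx (\rank A) *m Y^T) [set x : 'cV[R]_n | A *m x = 0].
Proof.
set l := \rank A; move=> [XX YY AE hS].
have YY' : Y^T *m Y = 1%:M by exact: mulmx1C.
have XX' : X^T *m X = 1%:M by exact: mulmx1C.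
have Spid : S *m pid_mx l = S.
  apply/matrixP => i j; rewrite mxE (bigD1 j)//= big1 ?addr0 => [|k kj]; last first.
    by rewrite mxE (_ : (k == j :> nat) = false) ?mulr0//; apply/negbTE.
  rewrite mxE eqxx /=; case: ltnP => [_|lj]; rewrite ?mulr1 ?mulr0//.
  have [h1 _ h3] := hS i j; apply/esym.
  by have [ij|/h1//] := eqVneq (i : nat) j; apply: h3 => //; rewrite ij.
have pid0 (z : 'cV[R]_n) : A *m z = 0 -> pid_mx l *m (Y^T *m z) = 0 :> 'cV_n.
  move=> Az; set u := Y^T *m z.
  have Su : S *m u = 0.
    rewrite /u mulmxA; have -> : S *m Y^T = X^T *m A.
      by rewrite AE !mulmxA XX' mul1mx.
    by rewrite -mulmxA Az mulmx0.
  apply/matrixP => j k; rewrite ord1 [RHS]mxE mxE (bigD1 j)//= big1 ?addr0; last first.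
    move=> i ij; rewrite mxE (_ : (j == i :> nat) = false) ?mul0r//.
    by apply/negbTE; rewrite eq_sym.
  rewrite mxE eqxx /=; case: ltnP => [jl|_]; last by rewrite mul0r.
  (* A column index below the rank is also a row index, so the diagonal entry exists. *)
  have jm : (j < m)%N by rewrite (leq_trans jl)// rank_leq_row.
  have /matrixP/(_ (Ordinal jm) ord0) := Su.
  rewrite [RHS]mxE mxE (bigD1 j)//= big1 ?addr0 => [/eqP|i ij]; last first.
    have [h1 _ _] := hS (Ordinal jm) i; rewrite h1 ?mul0r//=.
    by rewrite eq_sym.
  have [_ h2 _] := hS (Ordinal jm) j.
  by rewrite mulf_eq0 gt_eqF ?h2//= => /eqP ->; rewrite mulr0.
move=> x; split=> /=.
  have Scopid : S *m copid_mx l = 0 by rewrite mulmxBr mulmx1 Spid subrr.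
  rewrite {1}AE -!mulmxA (mulmxA Y^T Y) YY' mul1mx (mulmxA S) Scopid.
  by rewrite mul0mx mulmx0.
move=> d /= Ad.
have -> : x - Y *m copid_mx l *m Y^T *m x = Y *m (pid_mx l *m (Y^T *m x)).
  rewrite /copid_mx mulmxBr mulmx1 !mulmxBl YY mul1mx -!mulmxA opprB addrC subrK.
  by [].
by rewrite dot_mulmxl dot_mulmxl tr_pid_mx (pid0 _ Ad) dot0r.
Qed.

End SingularValues.

(** * The two convergence statements at the level of matrices *)

Section Conclusions.
Context (R : realType) (n m : nat) (gR gJ theta : R).

Lemma MPD1_convergent (HR HF : 'M[R]_n) (HJ HG : 'M[R]_m) (L : 'M[R]_(m, n))
    (bF bG ell : R) :
  let M := MPD gR gJ theta (invmx (1%:M + HR)) HF (invmx (1%:M + HJ)) HG L in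
  0 < gR -> 0 < gJ -> sym_psd HR -> sym_psd HJ -> sym_psd HF -> sym_psd HG ->
  theta = 1 -> 0 < bF -> 0 < bG -> 0 <= ell ->
  (forall x, dot x (HF *m x) <= bF^-1 * dot x x) ->
  (forall v, dot v (HG *m v) <= bG^-1 * dot v v) ->
  (forall x, norm2 (L *m x) <= ell * norm2 x) ->
  2 * Num.min bF bG * Num.min gJ^-1 gR^-1
    * (1 - Num.sqrt (gJ * gR * ell ^+ 2)) > 1 ->
  exists Minf : 'M[R]_(n + m),
    [/\ (fun k : nat => M ^+ k) @ \oo --> Minf,
        is_orth_proj Minf [set z | M *m z = z],
        forall k : nat, (0 < k)%N -> M ^+ k - Minf = (M - Minf) ^+ k,
        spectral_radius (M - Minf) < 1
      & forall rho : R, spectral_radius (M - Minf) < rho -> rho < 1 ->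
          exists (K : nat) (C : R), forall k : nat, (K <= k)%N ->
            opnorm (M ^+ k - Minf) <= C * rho ^+ k].
Proof.
move=> M gR0 gJ0 pR pJ pF pG th1 bF0 bG0 ell0 hF hG hL hstep.
have hM (z : 'cV[R]_(n + m)) : M *m z = z -> M^T *m z = z.
  exact: MPD1_trmx_fixed.
have [P hP] := exists_orth_proj_fixed M.
have sr1 : spectral_radius (M - P) < 1.
  apply: spectral_radius_lt => // z Nz.
  have [->|z0] := eqVneq z 0; first by rewrite Normc.normc0.
  have [x [y [xy Px Py Mx My]]] := cspectrum_sub_proj hP hM Nz z0.
  have Mz : cspectrum M z by apply/cspectrumP; exists x, y.
  have [z1|//] := MPD1_cspectrum gR0 gJ0 pR pJ pF pG th1 bF0 bG0 ell0 hF hG hL hstep Mz.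
  by case: (cspectrum_sub_proj_neq1 hP hM); rewrite -z1.
exists P; split=> //.
- exact: cvg_fixed_proj.
- exact: fixed_proj_power.
(* K = 1, the first exponent for which the power identity holds. *)
- move=> rho /opnorm_power_rate[c hc] _; exists 1%N, c => k k0.
  by rewrite (fixed_proj_power hP hM)// hc.
Qed.

Lemma polyhedral_convergent (L : 'M[R]_(m, n)) (ell : R) :
  let M := MPD gR gJ theta (invmx (1%:M + 0)) 0 (invmx (1%:M + 0)) 0 L in
  let l := \rank L in
  0 < gR -> 0 < gJ -> 0 < theta -> theta <= 1 -> 0 <= ell ->
  (forall x, norm2 (L *m x) <= ell * norm2 x) -> gJ * gR * ell ^+ 2 < 1 ->
  exists Minf : 'M[R]_(n + m),
    [/\ (fun k : nat => M ^+ k) @ \oo --> Minf,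
        forall (X : 'M[R]_m) (S : 'M[R]_(m, n)) (Y : 'M[R]_n),
          is_svd L X S Y ->
          Minf = block_mx Y 0 0 X
                 *m block_mx (copid_mx l) 0 0 (copid_mx l)
                 *m block_mx Y^T 0 0 X^T,
        forall z : R[i], cspectrum (M - Minf) z ->
          complex.Im z != 0 \/ (z = 0 /\ (l + l < n + m)%N),
        (0 < l)%N ->
          spectral_radius (M - Minf)
            = Num.sqrt (1 - theta * gR * gJ * sigma_min L ^+ 2)
      & spectral_radius (M - Minf) < 1].
Proof.
move=> M l gR0 gJ0 th0 th1 ell0 hL hstep.
have hM := polyhedral_trmx_fixed gR0 gJ0 (L := L) (theta := theta).
have [P hP] := exists_orth_proj_fixed M.
have nonreal z := polyhedral_cspectrum_nonreal gR0 gJ0 th0 th1 ell0 hL hstep hP (z := z).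
have zero := polyhedral_cspectrum0 gR0 gJ0 th0 th1 ell0 hL hstep hP.
have attain := polyhedral_cspectrum_of_singular gR0 gJ0 th0 th1 ell0 hL hstep hP.
have fixE := @polyhedral_fixedE _ _ _ _ _ theta L gR0 gJ0.
rewrite -/M in hM nonreal zero attain fixE; clearbody M.
have g0 : 0 < gJ * gR by rewrite mulr_gt0.
have sr1 : spectral_radius (M - P) < 1.
  apply: spectral_radius_lt; first exact: ltr01.
  move=> z Nz.
  have [->|z0] := eqVneq z 0; first by rewrite Normc.normc0.
  have [_ [k [w [k0 _ _ ->]]]] := nonreal _ Nz z0.
  rewrite -[ltRHS]sqrtr1 ltr_sqrt//.
  by rewrite gtrBl mulr_gt0.
exists P; split; last exact: sr1.
- exact: cvg_fixed_proj.
(* By uniqueness it suffices that the block formula is an orthogonal projection onto ker L x ker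
   L^T. *)
- move=> X S Y hsvd; apply: (is_orth_proj_uniq (@fixed_pointsB _ _ M) hP).
  rewrite !mulmx_block !(mul0mx, mulmx0, addr0, add0r) => z.
  have [x [v ->]] := col_mxP z.
  have [Kx Ox] := is_svd_proj hsvd x.
  have [] := is_svd_proj (is_svd_tr hsvd) v; rewrite mxrank_tr -/l => Kv Ov.
  rewrite mul_block_col !mul0mx addr0 add0r; split=> /=.
    by apply/fixE; split.
  move=> d; have [y [w ->]] := col_mxP d => /fixE[Ly Lw].
  by rewrite opp_col_mx add_col_mx dot_col_mx Ox// Ov// addr0.
- move=> z Nz; have [z0|z0] := eqVneq z 0; last by left; exact: (nonreal _ Nz z0).1.
  right; split=> //; rewrite z0 in Nz.
  (* A non-zero kernel vector of L gives l < n, one of L^T gives l < m; either makes 2l < n + m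
     strict. *)
  have [x [v [xv Lx Lv]]] := zero Nz.
  have rank_lt (p q : nat) (A : 'M[R]_(p, q)) (y : 'cV[R]_q) : y != 0 -> A *m y = 0 -> (\rank A < q)%N.
    move=> y0 Ay; rewrite ltn_neqAle rank_leq_col andbT; apply: contra y0 => /eqP rq.
    have : row_full A by rewrite /row_full rq.
    case/row_fullP => B BA.
    by rewrite -[y]mul1mx -BA -mulmxA Ay mulmx0.
  have ln := rank_leq_col L; have lm := rank_leq_row L; rewrite -/l in ln lm.
  case/orP: xv => [x0|v0].
    have := rank_lt _ _ _ _ x0 Lx; rewrite -/l => h.
    by rewrite -addSn leq_add.
  have := rank_lt _ _ _ _ v0 Lv; rewrite mxrank_tr -/l => h.
  by rewrite -addnS leq_add.
- move=> l0; have [[s0 /eigenvalue_cVP[x x0 Ax]] sn0] := sigma_minP l0.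
  set s := sigma_min L in s0 sn0 Ax *.
  have s2 : 0 < s ^+ 2 by rewrite exprn_gt0// lt_neqAle eq_sym sn0.
  apply: spectral_radius_eq.
    move=> z Nz; have [->|z0] := eqVneq z 0; first by rewrite Normc.normc0 sqrtr_ge0.
    have [_ [k [w [k0 w0 Lw ->]]]] := nonreal _ Nz z0.
    (* L^T w is an eigenvector of L^T L for k / (gJ gR), whose root is thus a non-zero singular
       value, at least [s]. *)
    rewrite ler_wsqrtr// lerD2l lerN2 -!mulrA ler_pM2l// mulrA [gR * gJ]mulrC.
    have Lw0 : L^T *m w != 0.
      apply: contraNneq w0 => h; move: Lw; rewrite h mulmx0 scaler0 => /esym/eqP.
      by rewrite scaler_eq0 (gt_eqF k0).
    have kg0 : 0 < k / (gJ * gR) by rewrite divr_gt0.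
    have sv : singular_value L (Num.sqrt (k / (gJ * gR))).
      split; first exact: sqrtr_ge0.
      rewrite sqr_sqrtr ?(ltW kg0)//; apply/eigenvalue_cVP; exists (L^T *m w) => //.
      rewrite -mulmxA; apply: (scalerI (lt0r_neq0 g0)).
      by rewrite scalemxAr Lw -scalemxAr scalerA mulrCA mulfV ?mulr1// lt0r_neq0.
    have := sigma_min_le sv; rewrite sqrtr_eq0 -ltNge kg0 => /(_ isT).
    rewrite -/s => sk; have : s ^+ 2 <= Num.sqrt (k / (gJ * gR)) ^+ 2.
      by rewrite ler_pXn2r ?nnegrE ?sqrtr_ge0.
    by rewrite sqr_sqrtr ?(ltW kg0)// ler_pdivlMr// [s ^+ 2 * _]mulrC.
  (* L x carries the eigenvalue [s ^+ 2] over to L L^T, from which [attain] produces the extremal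
     modulus. *)
  have Lx0 : L *m x != 0.
    apply: contraNneq x0 => h; move: Ax; rewrite -mulmxA h mulmx0 => /esym/eqP.
    by rewrite scaler_eq0 (gt_eqF s2).
  have LLx : L *m (L^T *m (L *m x)) = s ^+ 2 *: (L *m x).
    by rewrite (mulmxA L^T) Ax -scalemxAr.
  have [z Nz zE] := attain _ _ s2 Lx0 LLx.
  exists z => //; rewrite zE; congr (Num.sqrt (1 - _)); ring.
Qed.

End Conclusions.

(** * Hessians of smooth and convex functions *)

Section SecondOrder.
Context (R : realType).

Lemma derive_grad n (f : 'cV[R]_n -> R) x v : differentiable f x ->
  'D_v f x = dot (grad f x) v.
Proof.
move=> df; rewrite deriveE// {1}(matrix_sum_delta v) linear_sum /dot.
by apply: eq_bigr => i _; rewrite big_ord1 linearZ/= mxE deriveE// mulrC.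
Qed.

Lemma differentiable_dot_grad n (f : 'cV[R]_n -> R) x u :
  differentiable (grad f) x ->
  differentiable (fun y => dot (grad f y) u) x /\
  forall v, 'D_v (fun y => dot (grad f y) u) x = dot u (hess f x *m v).
Proof.
move=> dg; pose g i := (fun y => grad f y i ord0) : 'cV[R]_n -> R.
have dgi i : differentiable (g i) x.
  exact: (differentiable_comp dg (differentiable_coord _ i ord0)).
have -> : (fun y => dot (grad f y) u) = \sum_(i < n) (u i ord0 \*: g i).
  apply/funext => y; rewrite fct_sumE; apply: eq_bigr => i _.
  by rewrite mulrC.
have dZ i : differentiable (u i ord0 \*: g i) x by exact: differentiableZ.
split=> [|v]; first exact: differentiable_sum.
rewrite derive_sum => [|i]; last exact: diff_derivable.
apply: eq_bigr => i _; rewrite deriveZ; last exact: diff_derivable.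
rewrite derive_grad// mxE; congr (_ * _); apply: eq_bigr => j _.
by rewrite !mxE.
Qed.

Lemma differentiable_expansion n (f : 'cV[R]_n -> R) (x : 'cV[R]_n) (e : R) :
  differentiable f x -> 0 < e ->
  exists2 d : R, 0 < d & forall w : 'cV[R]_n, `|w| < d ->
    `|f (x + w) - f x - 'D_w f x| <= e * `|w|.
Proof.
move=> df e0; have := diff_locallyx df => /funext/eqaddoP/(_ e e0).
move=> /nbhs_ballP[d /= d0 hd]; exists d => // w wd.
have /hd /= : ball 0 d w by rewrite -ball_normE /= sub0r normrN.
move=> h; rewrite (_ : _ - _ = f (w + x) - (f x + 'd f x w)); first exact: h.
by rewrite deriveE// [w + x]addrC; ring.
Qed.

Lemma is_derive_line n (f : 'cV[R]_n -> R) x u (s : R) :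
  differentiable f (x + s *: u) ->
  is_derive s 1 (fun s => f (x + s *: u)) (dot (grad f (x + s *: u)) u).
Proof.
move=> df; have E : (fun h => h^-1 *: (((fun s => f (x + s *: u)) \o shift s) (h *: 1)
    - f (x + s *: u))) =
    (fun h : R => h^-1 *: ((f \o shift (x + s *: u)) (h *: u) - f (x + s *: u))).
  apply/funext => h /=; congr (_ *: (f _ - _)).
  by rewrite -[h *: 1]/(h * 1) mulr1 scalerDl addrCA addrC.
have D : derivable f (x + s *: u) u by exact: diff_derivable.
by apply: DeriveDef; [rewrite /derivable E|rewrite /derive E -derive_grad].
Qed.

(* The increment of s |-> f (x + s u + t v) - f (x + s u) is t times the
   variation of the partial derivative along u, by the mean value theorem. *)
Lemma second_difference n (f : 'cV[R]_n -> R) (x u v : 'cV[R]_n) (e : R) :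
  (\forall y \near x, differentiable f y) -> differentiable (grad f) x -> 0 < e ->
  exists2 d : R, 0 < d & forall t : R, 0 < t -> t < d ->
    `|f (x + t *: u + t *: v) - f (x + t *: u) - f (x + t *: v) + f x
      - dot u (hess f x *m v) * t ^+ 2| <= e * t ^+ 2.
Proof.
move=> /nbhs_ballP[r /= r0 hr] dg e0.
have [dpsi psiE] := differentiable_dot_grad u dg.
set psi := (fun y => _) in dpsi psiE.
pose c := `|u| + `|v| + 1.
have c0 : 0 < c by rewrite ltr_wpDl// addr_ge0.
(* Two first-order expansions are used, each with error at most e1 t c, so together e t; t c bounds
   the displacements. *)
pose e1 := e / (2 * c); have e10 : 0 < e1 by rewrite divr_gt0// mulr_gt0.
have [d d0 hd] := differentiable_expansion dpsi e10.
pose m := Num.min r d; have m0 : 0 < m by rewrite lt_min r0.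
exists (m / c); first by rewrite divr_gt0.
move=> t t0; rewrite ltr_pdivlMr// => tc.
have small (a b : R) : `|a| <= t -> `|b| <= t -> `|a *: u + b *: v| <= t * c.
  move=> at1 bt; rewrite (le_trans (ler_normD _ _))// !normrZ /c !mulrDr mulr1.
  by rewrite -[leLHS]addr0 lerD ?(ltW t0)// lerD// ler_wpM2r.
have dif (a b : R) : `|a| <= t -> `|b| <= t -> differentiable f (x + b *: v + a *: u).
  move=> at1 bt; apply: hr; rewrite -ball_normE /= -addrA opprD addrA subrr sub0r normrN.
  rewrite addrC (le_lt_trans (small _ _ at1 bt))// (lt_le_trans tc)// /m.
  by rewrite ge_min lexx.
pose g s := f (x + t *: v + s *: u) - f (x + 0 *: v + s *: u).
pose dgs s := psi (x + t *: v + s *: u) - psi (x + 0 *: v + s *: u).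
have g' (s : R) : `|s| <= t -> is_derive s (1 : R) g (dgs s).
  move=> st; apply: is_deriveB.
    by apply: is_derive_line; apply: dif => //; rewrite ger0_norm// ltW.
  by apply: is_derive_line; apply: dif => //; rewrite normr0 ltW.
have [s] : exists2 s, s \in `]0, t[%R & g t - g 0 = dgs s * (t - 0).
  apply: MVT => // [s|].
    rewrite in_itv /= => /andP[s0 st]; apply: g'.
    by rewrite ger0_norm ltW.
  apply: derivable_within_continuous => s; rewrite in_itv /= => /andP[s0 st].
  have [] := g' s => //; by rewrite ger0_norm.
rewrite in_itv /= => /andP[s0 st]; rewrite subr0 => gE.
have tt : `|t| <= t by rewrite ger0_norm// ltW.
have t00 : `|0 : R| <= t by rewrite normr0 ltW.
have sst : `|s| <= t by rewrite ger0_norm ltW.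
have lt_d (w : 'cV[R]_n) : `|w| <= t * c -> `|w| < d.
  by move=> /le_lt_trans; apply; rewrite (lt_le_trans tc)// /m ge_min lexx orbT.
have h1 := hd _ (lt_d _ (small s t sst tt)).
have h2 := hd _ (lt_d _ (small s 0 sst t00)).
have lin a b : 'D_(a *: u + b *: v) psi x = a * 'D_u psi x + b * 'D_v psi x.
  by rewrite !psiE mulmxDr -!scalemxAr dotDr !dotZr.
have lhs : f (x + t *: u + t *: v) - f (x + t *: u) - f (x + t *: v) + f x = dgs s * t.
  rewrite -gE /g !scale0r !addr0 [x + t *: v + t *: u]addrAC opprB.
  by rewrite addrA addrAC -addrA addrACA [RHS]addrA; ring.
rewrite lhs -psiE.
have -> : dgs s * t - 'D_v psi x * t ^+ 2 =
  t * ((psi (x + (s *: u + t *: v)) - psi x - 'D_(s *: u + t *: v) psi x)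
    - (psi (x + (s *: u + 0 *: v)) - psi x - 'D_(s *: u + 0 *: v) psi x)).
  have E (a : R) : x + (s *: u + a *: v) = x + a *: v + s *: u by rewrite addrA addrAC.
  rewrite !lin !E /dgs.
  move: (psi (x + t *: v + s *: u)) (psi (x + 0 *: v + s *: u)) (psi x).
  by move: ('D_u psi x) ('D_v psi x) => D1 D2 A B C; ring.
rewrite normrM ger0_norm ?(ltW t0)//.
have bound : e1 * (t * c) + e1 * (t * c) = e * t.
  by rewrite /e1; field; rewrite lt0r_neq0.
rewrite expr2 mulrCA ler_pM2l// -bound.
rewrite (le_trans (ler_normB _ _))// lerD//.
  by rewrite (le_trans h1)// ler_pM2l// small.
by rewrite (le_trans h2)// ler_pM2l// small.
Qed.

Lemma quadratic_limit_le (a C : R) (D : R -> R) :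
  (forall e : R, 0 < e -> exists2 d : R, 0 < d & forall t : R, 0 < t -> t < d ->
     `|D t - a * t ^+ 2| <= e * t ^+ 2) ->
  (exists2 d : R, 0 < d & forall t : R, 0 < t -> t < d -> D t <= C * t ^+ 2) ->
  a <= C.
Proof.
move=> hD [d' d'0 hC]; apply/ler_addgt0Pr => e e0.
have [d d0 hd] := hD e e0; set t := Num.min d d' / 2.
have m0 : 0 < Num.min d d' by rewrite lt_min d0.
have t0 : 0 < t by rewrite divr_gt0.
have tm : t < Num.min d d' by rewrite /t; lra.
have td : t < d by rewrite (lt_le_trans tm)// ge_min lexx.
have td' : t < d' by rewrite (lt_le_trans tm)// ge_min lexx orbT.
have := hd t t0 td; have := hC t t0 td'; rewrite ler_distlC => h1 /andP[h2 h3].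
by rewrite -(@ler_pM2r _ (t ^+ 2)) ?exprn_gt0// mulrDl; lra.
Qed.

Section Hessian.
Context n (f : 'cV[R]_n -> R) (x : 'cV[R]_n).
Hypothesis df : \forall y \near x, differentiable f y.
Hypothesis dg : differentiable (grad f) x.

(** The second difference is symmetric in u and v, and its quotient by t^2 has both mixed forms as
    limit. *)
Lemma hess_sym : (hess f x)^T = hess f x.
Proof.
suff le (u v : 'cV[R]_n) : dot u (hess f x *m v) <= dot v (hess f x *m u).
  apply: dot_mulmx_inj => u v; rewrite dot_mulmxr trmxK dotC.
  by apply/eqP; rewrite eq_le !le.
apply/ler_addgt0Pr => e e0; have e2 : 0 < e / 2 by rewrite divr_gt0.
have [d d0 hd] := second_difference v u df dg e2.
rewrite -lerBlDl.
apply: (quadratic_limit_le (D := fun t => f (x + t *: u + t *: v) - f (x + t *: u)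
  - f (x + t *: v) + f x - dot v (hess f x *m u) * t ^+ 2)).
  move=> e' e'0; have [d' d'0 hd'] := second_difference u v df dg e'0.
  exists d' => // t t0 td; have := hd' t t0 td.
  by congr (`|_| <= _); ring.
exists d => // t t0 td; have := hd t t0 td.
rewrite ler_distlC => /andP[h _].
have : e / 2 * t ^+ 2 <= e * t ^+ 2.
  by rewrite ler_wpM2r ?sqr_ge0//; lra.
rewrite [x + t *: v + _]addrAC in h; lra.
Qed.

(** The second difference in the directions h and -h is minus the centred one. *)
Lemma hess_le h C :
  (exists2 d : R, 0 < d & forall t : R, 0 < t -> t < d ->
    f (x + t *: h) + f (x - t *: h) - 2 * f x <= C * t ^+ 2) ->
  dot h (hess f x *m h) <= C.
Proof.
move=> hC; apply: (quadratic_limit_le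
  (D := fun t => f (x + t *: h) + f (x - t *: h) - 2 * f x)).
  move=> e e0; have [d d0 hd] := second_difference h (- h) df dg e0.
  exists d => // t t0 td; have := hd t t0 td.
  rewrite mulmxN dotNr scalerN addrK -normrN.
  by congr (`|_| <= _); ring.
exact: hC.
Qed.

Lemma hess_ge0 h :
  (exists2 d : R, 0 < d & forall t : R, 0 < t -> t < d ->
    2 * f x <= f (x + t *: h) + f (x - t *: h)) ->
  0 <= dot h (hess f x *m h).
Proof.
move=> [d' d'0 hC]; rewrite -oppr_le0; apply: (quadratic_limit_le
  (D := fun t => - (f (x + t *: h) + f (x - t *: h) - 2 * f x))).
  move=> e e0; have [d d0 hd] := second_difference h (- h) df dg e0.
  exists d => // t t0 td; have := hd t t0 td.
  rewrite mulmxN dotNr scalerN addrK.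
  by congr (`|_| <= _); ring.
by exists d' => // t t0 td; have := hC t t0 td; lra.
Qed.

Lemma hess_le_lipschitz h C :
  (forall y, norm2 (grad f y - grad f x) <= C * norm2 (y - x)) ->
  dot h (hess f x *m h) <= C * dot h h.
Proof.
move=> hC; have [dpsi psiE] := differentiable_dot_grad h dg.
apply/ler_addgt0Pr => e e0; pose e1 := e / (`|h| + 1).
have h1 : 0 < `|h| + 1 by rewrite ltr_wpDl.
have e10 : 0 < e1 by rewrite divr_gt0.
have [d d0 hd] := differentiable_expansion dpsi e10.
set t := d / (`|h| + 1) / 2.
have t0 : 0 < t by rewrite !divr_gt0.
have th : `|t *: h| < d.
  rewrite normrZ ger0_norm ?(ltW t0)// /t.
  have -> : d / (`|h| + 1) / 2 * `|h| = d * (`|h| / (`|h| + 1) / 2) by ring.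
  rewrite gtr_pMr// ltr_pdivrMr// mul1r ltr_pdivrMr// mulrDr mulr1.
  by have := normr_ge0 h; lra.
have := hd _ th; rewrite psiE -scalemxAr dotZr normrZ ger0_norm ?(ltW t0)//.
rewrite -dotBl ler_distlC => /andP[_ hup].
have := hC (x + t *: h); rewrite addrAC subrr add0r norm2Z ger0_norm ?(ltW t0)// => hL.
have := dot_le_norm2 (grad f (x + t *: h) - grad f x) h.
have := ler_wpM2r (norm2_ge0 h) hL => h2 h3.
rewrite -(ler_pM2l t0) mulrDr -sqr_norm2.
have : e1 * (t * `|h|) <= t * e.
  rewrite mulrCA ler_pM2l// /e1 -mulrA ler_piMr ?(ltW e0)//.
  by rewrite mulrC ler_pdivrMr// mul1r lerDl.
lra.
Qed.

End Hessian.
End SecondOrder.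

(** * Second-order bounds for Legendre-Fenchel conjugates *)

Section Conjugate.
Context (R : realType) (n : nat) (f : 'cV[R]_n -> \bar R).

Lemma conjugate_ge x v : ((dot x v)%:E - f x <= conjugate f v)%E.
Proof. by apply: ereal_sup_ubound; exists x. Qed.

Lemma conjugate_fin_ge x v c r : conjugate f v = c%:E -> f x = r%:E ->
  dot x v - r <= c.
Proof. by move=> vc fx; have := conjugate_ge x v; rewrite vc fx -EFinB lee_fin. Qed.

Lemma conjugate_fin_neqNy x v c : conjugate f v = c%:E -> f x != -oo%E.
Proof. by move=> vc; apply: contraPneq (conjugate_ge x v) => ->; rewrite vc. Qed.

Lemma conjugate_le v c d : conjugate f v = c%:E ->
  (forall x r, f x = r%:E -> dot x v - r <= d) -> c <= d.
Proof.
move=> vc h; rewrite -lee_fin -vc; apply: ge_ereal_sup => _ [x _ <-].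
have := conjugate_fin_neqNy x vc; case E : (f x) => [r| |] _.
- by rewrite -EFinB lee_fin h.
- by rewrite /= leNye.
- by have := conjugate_fin_neqNy x vc; rewrite E eqxx.
Qed.

Lemma conjugate_midpoint v h a b c : conjugate f (v + h) = a%:E ->
  conjugate f (v - h) = b%:E -> conjugate f v = c%:E -> 2 * c <= a + b.
Proof.
move=> va vb vc; rewrite mulrC -ler_pdivlMr//; apply: (conjugate_le vc) => x r fx.
have := conjugate_fin_ge va fx; have := conjugate_fin_ge vb fx.
by rewrite dotBr dotDr; lra.
Qed.

(** Points x and y competing in the suprema at v + h and v - h are compared with their midpoint in
    the supremum at v. Strong convexity gains b0/4 |x - y|^2, which pays for the cross term <x - y,
    h>. *)
Lemma conjugate_strongly_convex b0 v h a b c : 0 < b0 -> strongly_convex b0 f ->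
  conjugate f (v + h) = a%:E -> conjugate f (v - h) = b%:E ->
  conjugate f v = c%:E -> a + b - 2 * c <= b0^-1 * dot h h.
Proof.
move=> b00 sc va vb vc.
have key x y r s : f x = r%:E -> f y = s%:E ->
    (dot x (v + h) - r) + (dot y (v - h) - s) <= 2 * c + b0^-1 * dot h h.
  move=> fx fy; have := sc x y 2^-1; rewrite invr_gt0 ltr0n => /(_ isT).
  rewrite invf_lt1// ltr1n => /(_ isT); rewrite fx fy.
  have -> : 1 - 2^-1 = 2^-1 :> R by field.
  set z := _ *: x + _; have := conjugate_fin_neqNy z vc.
  case E : (f z) => [q| |] // _; rewrite -!EFinM -!EFinD lee_fin => h1.
  have := conjugate_fin_ge vc E; rewrite /z dotDl !dotZl => h2.
  have := dot_ge0 ((b0 / 2) *: (x - y) - h).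
  rewrite dotBl !dotBr !dotZl !dotZr -sqr_norm2 (dotC h) => h3.
  (* Expansion of |(b0/2)(x - y) - h|^2 >= 0, divided by b0. *)
  have h4 : dot (x - y) h <= b0 / 4 * norm2 (x - y) ^+ 2 + b0^-1 * dot h h.
    rewrite -(ler_pM2l b00) [leRHS]mulrDr mulVKf ?lt0r_neq0//.
    by move: h3; lra.
  by rewrite dotBl in h4; rewrite dotDr; lra.
rewrite -lerBrDr opprK -lerBrDr; apply: (conjugate_le va) => x r fx.
rewrite lerBrDr -lerBrDl; apply: (conjugate_le vb) => y s fy.
by have := key x y r s fx fy; lra.
Qed.

End Conjugate.

Section ConjugateHessian.
Context (R : realType) (n : nat) (f : 'cV[R]_n -> \bar R) (v : 'cV[R]_n).
Hypothesis hC2 : C2_near_ereal (conjugate f) v.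

Lemma near_line (P : set 'cV[R]_n) (h : 'cV[R]_n) : (\forall y \near v, P y) ->
  exists2 d : R, 0 < d & forall t : R, `|t| < d -> P (v + t *: h).
Proof.
move=> /nbhs_ballP[d /= d0 hd].
have h1 : 0 < `|h| + 1 by rewrite ltr_wpDl.
exists (d / (`|h| + 1)); first by rewrite divr_gt0.
move=> t; rewrite ltr_pdivlMr// => td; apply: hd.
rewrite -ball_normE /= opprD addrA subrr sub0r normrN normrZ.
by apply: le_lt_trans td; rewrite ler_wpM2l// lerDl.
Qed.

Lemma near_line_sym (P : set 'cV[R]_n) (h : 'cV[R]_n) : (\forall y \near v, P y) ->
  exists2 d : R, 0 < d & forall t : R, 0 < t -> t < d ->
    [/\ P (v + t *: h), P (v - t *: h) & P v].
Proof.
move=> hP; have [d d0 hd] := near_line h hP; exists d => // t t0 td.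
split; first by apply: hd; rewrite ger0_norm// ltW.
  by rewrite -scaleNr; apply: hd; rewrite normrN ger0_norm// ltW.
exact: nbhs_singleton.
Qed.

Lemma hess_conj_sym_psd : sym_psd (hess (fine \o conjugate f) v).
Proof.
have [hfin hC] := hC2.
have df : \forall y \near v, differentiable (fine \o conjugate f) y.
  by apply: filterS hC => y [].
have dg : differentiable (grad (fine \o conjugate f)) v.
  by have [] := nbhs_singleton hC.
split; first exact: hess_sym.
move=> h; apply: hess_ge0 => //.
have [d d0 hd] := near_line_sym h hfin; exists d => // t t0 td.
have [f1 f2 f3] := hd t t0 td.
by apply: (@conjugate_midpoint _ _ f v (t *: h)); rewrite /= fineK.
Qed.

Lemma hess_conj_le b : 0 < b -> strongly_convex b f ->
  forall h, dot h (hess (fine \o conjugate f) v *m h) <= b^-1 * dot h h.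
Proof.
move=> b0 sc h; have [hfin hC] := hC2.
have df : \forall y \near v, differentiable (fine \o conjugate f) y.
  by apply: filterS hC => y [].
have dg : differentiable (grad (fine \o conjugate f)) v.
  by have [] := nbhs_singleton hC.
apply: hess_le => //.
have [d d0 hd] := near_line_sym h hfin; exists d => // t t0 td.
have [f1 f2 f3] := hd t t0 td.
have -> : b^-1 * dot h h * t ^+ 2 = b^-1 * dot (t *: h) (t *: h).
  by rewrite dotZl dotZr; ring.
by apply: (@conjugate_strongly_convex _ _ f b v (t *: h)); rewrite //= fineK.
Qed.

End ConjugateHessian.

Section SmoothConvexHessian.
Context (R : realType) (n : nat) (f : 'cV[R]_n -> R) (x : 'cV[R]_n).
Hypothesis hC2 : C2_near f x.

Lemma hess_convex_sym_psd : convex_efun (fun x => (f x)%:E) -> sym_psd (hess f x).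
Proof.
move=> cf.
have df : \forall y \near x, differentiable f y by apply: filterS hC2 => y [].
have dg : differentiable (grad f) x by have [] := nbhs_singleton hC2.
split; first exact: hess_sym.
move=> h; apply: hess_ge0 => //; exists 1 => // t _ _.
have := cf (x + t *: h) (x - t *: h) 2^-1; rewrite invr_gt0 ltr0n => /(_ isT).
rewrite invf_lt1// ltr1n => /(_ isT); rewrite -!EFinM -!EFinD lee_fin.
have -> : 1 - 2^-1 = 2^-1 :> R by field.
have -> : 2^-1 *: (x + t *: h) + 2^-1 *: (x - t *: h) = x.
  by apply/matrixP => i j; rewrite !mxE; field.
lra.
Qed.

Lemma hess_lipschitz_le b :
  (forall x y, norm2 (grad f x - grad f y) <= b * norm2 (x - y)) ->
  forall h, dot h (hess f x *m h) <= b * dot h h.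
Proof.
move=> fl h; apply: hess_le_lipschitz => //.
by have [] := nbhs_singleton hC2.
Qed.

End SmoothConvexHessian.

(** * Riemannian Hessians at a minimizer *)

Section RiemannianHessian.
Context (R : realType).

Lemma is_derive_expansion (V : normedModType R) (phi : R -> V) (a : V) (e : R) :
  is_derive (0 : R) (1 : R) phi a -> 0 < e ->
  exists2 d : R, 0 < d & forall t : R, `|t| < d ->
    `|phi t - phi 0 - t *: a| <= e * `|t|.
Proof.
move=> dphi e0; have df : differentiable phi (0 : R).
  by apply/derivable1_diffP; exact: ex_derive.
have := diff_locallyx df => /funext/eqaddoP/(_ e e0) /nbhs_ballP[d /= d0 hd].
exists d => // t td; have /hd /= : ball (0 : R) d t.
  by rewrite -ball_normE /= sub0r normrN.
move=> h; rewrite (_ : _ - _ = phi (t + 0) - (phi 0 + 'd phi 0 t)); first exact: h.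
rewrite addr0 opprD addrA; congr (_ - _).
by rewrite -[in RHS](mulr1 t) linearZ/= -deriveE// derive_val.
Qed.

(** The derivative vanishes at 0, so a < 0 would make it negative just to the right, and the mean
    value theorem would give values below phi 0. *)
Lemma second_derivative_min_ge0 (phi : R -> R) (a : R) :
  has_second_derivative phi 0 a -> (\forall t \near (0 : R), phi 0 <= phi t) ->
  0 <= a.
Proof.
move=> [/nbhs_ballP[r1 /= r10 hd] da] /nbhs_ballP[r2 /= r20 hmin].
rewrite leNgt; apply/negP => a0.
pose r := Num.min r1 r2; have r0 : 0 < r by rewrite lt_min r10.
have rr t : `|t| < r -> derivable phi t 1 /\ phi 0 <= phi t.
  rewrite lt_min => /andP[t1 t2].
  by split; [apply: hd|apply: hmin]; rewrite -ball_normE /= sub0r normrN.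
have d0 : derive1 phi 0 = 0.
  have [||||D E] := @derive1_at_min R phi (- r) r 0.
  - by rewrite ge0_cp// ltW.
  - move=> t; rewrite in_itv /= => /andP[t1 t2]; apply: (rr t _).1.
    by rewrite ltr_norml t1.
  - by rewrite in_itv /= oppr_lt0 r0.
  - move=> t; rewrite in_itv /= => /andP[t1 t2]; apply: (rr t _).2.
    by rewrite ltr_norml t1.
  by rewrite derive1E E.
have e0 : 0 < - (a / 2) by lra.
have [d dp hexp] := is_derive_expansion da e0.
pose t := Num.min r d / 2.
have m0 : 0 < Num.min r d by rewrite lt_min r0.
have t0 : 0 < t by rewrite divr_gt0.
have tm : t < Num.min r d by rewrite /t; lra.
have tr : t < r by rewrite (lt_le_trans tm)// ge_min lexx.
have td : t < d by rewrite (lt_le_trans tm)// ge_min lexx orbT.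
have [s] : exists2 s, s \in `]0, t[%R & phi t - phi 0 = derive1 phi s * (t - 0).
  apply: MVT => // [s|].
    rewrite in_itv /= => /andP[s0 st]; rewrite derive1E; apply: derivableP.
    by apply: (rr s _).1; rewrite ger0_norm ?(ltW s0)// (lt_trans st).
  apply: derivable_within_continuous => s; rewrite in_itv /= => /andP[s0 st].
  by apply: (rr s _).1; rewrite ger0_norm// (le_lt_trans st).
rewrite in_itv /= subr0 => /andP[s0 st] E.
have /hexp : `|s| < d by rewrite ger0_norm ?(ltW s0)// (lt_trans st).
rewrite d0 subr0 [`|s|]ger0_norm ?(ltW s0)// ler_distl => /andP[_ hs].
have hs' : derive1 phi s < 0.
  apply: le_lt_trans hs _; rewrite -[s *: a]/(s * a).
  have : s * a < 0 by rewrite pmulr_rlt0.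
  lra.
have [|_] := rr t; first by rewrite ger0_norm// ltW.
by rewrite leNgt => /negP; apply; rewrite -subr_lt0 E pmulr_llt0.
Qed.

Lemma nearest_id n (M : set 'cV[R]_n) x : M x -> nearest M x = x.
Proof.
move=> Mx; rewrite /nearest; case: xgetP => [y _ [My hy]|//].
have := hy x Mx; rewrite subrr norm2_0 => h.
have /eqP : norm2 (x - y) = 0 by apply/eqP; rewrite eq_le h norm2_ge0.
by rewrite norm2_eq0 subr_eq0 => /eqP.
Qed.

Lemma riem_hess_psd n (M : set 'cV[R]_n) (f : 'cV[R]_n -> \bar R) x :
  M x -> f x \is a fin_num -> (forall y, (f x <= f y)%E) ->
  sym_psd (oproj (tangent_space M x) *m riem_hess M f x *m oproj (tangent_space M x)).
Proof.
move=> Mx fx fmin; set T := tangent_space M x.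
have psd0 k (A B : 'M[R]_k) : A = 0 -> sym_psd (B *m A *m B).
  by move=> ->; rewrite mulmx0 mul0mx; exact: sym_psd0.
rewrite /riem_hess; case: xgetP => [H _ [sH HT HO H2]|_]; last exact: psd0.
rewrite {1 2}/oproj; case: xgetP => [P _ hP|_]; last first.
  by rewrite !mul0mx; exact: sym_psd0.
have [sP _] := is_orth_proj_projector hP.
split=> [|y]; first by rewrite !trmx_mul sP sH mulmxA.
rewrite -!mulmxA dot_mulmxr sP dotC; set h := P *m y.
have Th : T h by exact: (hP y).1.
have D2 := H2 h Th; apply: (second_derivative_min_ge0 D2).
set phi := (fun t => _) in D2 *.
have phi0 : phi 0 = fine (f x) by rewrite /phi scale0r addr0 nearest_id.
have phic : {for (0 : R), continuous phi}.
  apply: differentiable_continuous; apply/derivable1_diffP.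
  exact: nbhs_singleton D2.1.
have fxE : f x = (phi 0)%:E by rewrite phi0 fineK.
(* [fine] sends +oo to 0, so phi could drop to 0 where f is infinite. This is harmless if phi 0 <=
   0; otherwise continuity at 0 keeps phi positive nearby. *)
have main t : phi 0 <= 0 \/ 0 < phi t -> phi 0 <= phi t.
  rewrite [phi t]/phi; have := fmin (nearest M (x + t *: h)); rewrite fxE.
  case: (f (nearest M (x + t *: h))) => [r| |]; rewrite ?lee_fin//=.
  by move=> _ [//|]; rewrite ltxx.
have [p0|p0] := leP (phi 0) 0; first by apply: (@filterE R (nbhs (0 : R))) => t; apply: main; left.
have : \forall t \near (0 : R), 0 < phi t.
  exact: (cvgr_gt _ phic _ p0).
by apply: filterS => t pt; apply: main; right.
Qed.

End RiemannianHessian.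

(** * Partly smooth functions that are locally polyhedral *)

Section Tilt.
Context (R : realType) (n : nat).
Implicit Types (f : 'cV[R]_n -> \bar R) (x y c g h : 'cV[R]_n).

(** Common form of [Rbar] and [Jbar]: the Kuhn-Tucker inclusions say that -c is a subgradient, hence
    that the point minimizes the tilted function. *)
Definition tilt f c : 'cV[R]_n -> \bar R := fun y => (f y + (dot y c)%:E)%E.

Lemma subdiff_fin f x g : proper_fun f -> subdiff f x g ->
  exists r, f x = r%:E.
Proof.
move=> [[y fy] fN] /(_ y); have := fN x; case: (f x) => [r _ _|_|//].
  by exists r.
by move=> h; move: (le_lt_trans h fy).
Qed.

Lemma subdiff_le f x y g r s : subdiff f x g -> f x = r%:E -> f y = s%:E ->
  r + dot g (y - x) <= s.
Proof. by move=> /(_ y) + fx fy; rewrite fx fy -EFinD lee_fin. Qed.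

Lemma tilt_min f c x : proper_fun f -> subdiff f x (- c) ->
  tilt f c x \is a fin_num /\ forall y, (tilt f c x <= tilt f c y)%E.
Proof.
move=> pf hc; have [r fx] := subdiff_fin pf hc.
rewrite /tilt fx; split=> // y; have := hc y; rewrite fx.
case: (f y) => [s| |]; rewrite -?EFinD ?lee_fin//= ?leey//.
by rewrite dotNl dotBr (dotC c y) (dotC c x); lra.
Qed.

Lemma entry_le_mx_norm (r : 'cV[R]_n) i : `|r i ord0| <= `|r|.
Proof.
rewrite leNgt; apply/negP => h.
have : ball (0 : 'cV[R]_n) `|r i ord0| r by rewrite -ball_normE /= sub0r normrN.
by case=> _ /(_ i ord0); rewrite -ball_normE /= mxE sub0r normrN ltxx.
Qed.

Lemma dot_le_mx_norm (r w : 'cV[R]_n) :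
  `|dot r w| <= (\sum_i `|w i ord0|) * `|r|.
Proof.
rewrite mulr_suml (le_trans (ler_norm_sum _ _ _))//; apply: ler_sum => i _.
by rewrite normrM mulrC ler_wpM2l// entry_le_mx_norm.
Qed.

Lemma near_dot_lt (x w : 'cV[R]_n) (e : R) : 0 < e ->
  \forall y \near x, `|dot (y - x) w| < e.
Proof.
move=> e0; pose C := \sum_i `|w i ord0| + 1.
have C0 : 0 < C by rewrite ltr_wpDl// sumr_ge0.
apply/nbhs_ballP; exists (e / C); first by rewrite /= divr_gt0.
move=> y; rewrite -ball_normE /= distrC ltr_pdivlMr// => h.
apply: le_lt_trans h; rewrite (le_trans (dot_le_mx_norm _ _))// mulrC.
by rewrite ler_wpM2l// lerDl.
Qed.

Lemma near_norm2_lt x (e : R) : 0 < e -> \forall y \near x, norm2 (y - x) < e.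
Proof.
move=> e0; have n0 : 0 < n.+1%:R :> R by rewrite ltr0n.
apply/nbhs_ballP; exists (e / n.+1%:R); first by rewrite /= divr_gt0.
move=> y; rewrite -ball_normE /= distrC => h.
apply: le_lt_trans (norm2_le_sum _) _.
apply: (@le_lt_trans _ _ (\sum_(i < n) `|y - x|)).
  by apply: ler_sum => i _; exact: entry_le_mx_norm.
rewrite sumr_const card_ord -mulr_natr; move: h; rewrite ltr_pdivlMr//.
apply: le_lt_trans; rewrite ler_wpM2l// ler_nat.
exact: leqnSn.
Qed.

Lemma near_of_entries x (P : set 'cV[R]_n) : (\forall y \near x, P y) ->
  exists2 e : R, 0 < e & forall y, (forall i, `|(y - x) i ord0| < e) -> P y.
Proof.
move=> /nbhs_ballP[e /= e0 he]; exists e => // y hy; apply: he.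
split=> // i j; rewrite ord1 -ball_normE /= distrC.
by have := hy i; rewrite !mxE.
Qed.

End Tilt.

Section LocallyPolyhedral.
Context (R : realType) (n : nat) (f : 'cV[R]_n -> \bar R) (x c : 'cV[R]_n).
Context (M : set 'cV[R]_n).
Hypothesis hpoly : locally_polyhedral f x.
Hypothesis hps : PSF f x M.
Hypothesis hc : subdiff f x (- c).

(* Scaling the displacement preserves the constraints active at (x, f x), and
   the inactive ones hold near x. *)
Lemma locally_polyhedral_double (g : 'cV[R]_n -> R) :
  {for x, continuous g} -> f x = (g x)%:E ->
  (\forall y \near x, M y -> f y = (g y)%:E) ->
  \forall y \near x, M y ->
    (f (x + 2 *: (y - x)) <= (g x + 2 * (g y - g x))%:E)%E.
Proof.
move=> gc fx hg; have [q [k [A [a [b hq]]]] fq] := hpoly.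
pose u i := A^T *m delta_mx i ord0 : 'cV[R]_n.
have uE i z : (A *m z) i ord0 = dot z (u i) by rewrite dot_mulmxr trmxK dot_delta.
pose sg i := b i ord0 - (dot x (u i) + a i ord0 * g x).
have sg0 i : 0 <= sg i.
  rewrite subr_ge0 -uE; apply: (hq x (g x)).1.
  by rewrite -(nbhs_singleton fq) fx.
have N1 : \forall y \near x, forall i, 0 < sg i ->
    2 * (dot (y - x) (u i) + a i ord0 * (g y - g x)) <= sg i.
  apply: (@filter_forall _ 'I_k (fun i y => 0 < sg i ->
    2 * (dot (y - x) (u i) + a i ord0 * (g y - g x)) <= sg i) (nbhs x)) => i.
  have [si|si] := ltP 0 (sg i); last first.
    by apply: (@filterE _ (nbhs x)).
  have a1 : 0 < `|a i ord0| + 1 by rewrite ltr_wpDl.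
  have e1 : 0 < sg i / 4 by rewrite divr_gt0.
  have e2 : 0 < sg i / 4 / (`|a i ord0| + 1) by rewrite divr_gt0.
  move: (near_dot_lt x (u i) e1) (gc) => hdot /cvgrPdist_lt/(_ _ e2); move: hdot.
  apply: filterS2 => y hd hgy _; have {}hd := le_lt_trans (ler_norm _) hd.
  have : a i ord0 * (g y - g x) <= sg i / 4.
    rewrite (le_trans (ler_norm _))// normrM distrC.
    apply: (@le_trans _ _ ((`|a i ord0| + 1) * (sg i / 4 / (`|a i ord0| + 1)))).
      by apply: ler_pM => //; [rewrite lerDl|exact: ltW].
    by rewrite mulrC divfK// lt0r_neq0.
  lra.
have N2 : \forall y \near x, f (x + 2 *: (y - x)) = q (x + 2 *: (y - x)).
  have [e e0 he] := near_of_entries fq.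
  apply/nbhs_ballP; exists (e / 2); first by rewrite /= divr_gt0.
  move=> y /=; rewrite -ball_normE /= distrC ltr_pdivlMr// => hy.
  apply: he => i; apply: le_lt_trans hy.
  rewrite addrAC subrr add0r (le_trans (entry_le_mx_norm _ _))// normrZ mulrC.
  by rewrite ger0_norm.
have N34 := @filterI _ _ (nbhs_filter x) _ _ hg fq.
move: N1 N2 N34; apply: filterS3 => y h1 h2 [h3 h4] My.
rewrite h2; apply/hq => i; rewrite uE dotDl dotZl.
have hy : dot y (u i) + a i ord0 * g y <= b i ord0.
  by rewrite -uE; apply: (hq y (g y)).1; rewrite -h4 h3.
have [si|] := ltP 0 (sg i).
  by have := h1 i si; rewrite /sg; lra.
rewrite /sg dotBl; lra.
Qed.

(** A subgradient at y, tested at x and at the reflected point 2y - x, has its slope along y - x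
    bounded on both sides by g y - g x. With equality, its supporting affine function also touches f
    at x. *)
Lemma PSF_subdiff_eq (g : 'cV[R]_n -> R) y g' :
  f x = (g x)%:E -> f y = (g y)%:E ->
  (f (x + 2 *: (y - x)) <= (g x + 2 * (g y - g x))%:E)%E ->
  subdiff f y g' -> dot g' (y - x) = g y - g x /\ subdiff f x g'.
Proof.
move=> fx fy fd hg'.
have e : dot g' (y - x) = g y - g x.
  apply/eqP; rewrite eq_le; apply/andP; split.
    have := hg' (x + 2 *: (y - x)); rewrite fy => h.
    have := le_trans h fd; rewrite lee_fin.
    have -> : x + 2 *: (y - x) - y = y - x.
      by apply/matrixP => i j; rewrite !mxE; ring.
    lra.
  by have := subdiff_le hg' fy fx; rewrite -(opprB y x) dotNr; lra.
split=> // z; have := hg' z; rewrite fx fy.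
have E2 : g x + dot g' (z - x) = g y + dot g' (z - y).
  by move: e; rewrite !dotBr; lra.
by rewrite -!EFinD E2.
Qed.

Hypothesis hnd : rel_int (subdiff f x) (- c) \/ is_affine M.

Lemma affine_tangent y : is_affine M -> M x -> M y -> tangent_space M x (y - x).
Proof.
move=> [_ hM] Mx My; exists (fun t => x + t *: (y - x)); split.
- by rewrite scale0r addr0.
- apply: (@filterE R (nbhs (0 : R))) => t.
  have -> : x + t *: (y - x) = t *: y + (1 - t) *: x.
    by apply/matrixP => i j; rewrite !mxE; ring.
  exact: hM.
- have ds : is_derive (0 : R) (1 : R) ( *:%R ^~ (y - x)) (y - x).
    apply: DeriveDef; first by apply: diff_derivable; exact: ex_diff.
    by rewrite deriveE ?diff_val ?scale1r//; exact: ex_diff.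
  by have := is_deriveD (is_derive_cst x (0 : R) (1 : R)) ds; rewrite add0r.
Qed.

Lemma aff_hull_mem (S : set 'cV[R]_n) y : S y -> aff_hull S y.
Proof.
move=> Sy; exists 1%N, (fun=> 1), (fun=> y).
by split=> //; rewrite big_ord1 ?scale1r.
Qed.

(** Inner semicontinuity supplies subgradients g' at nearby y in M, with slope g y - g x along y -
    x. It remains to see that -c has the same slope, from non-degeneracy or from affinity. *)
Lemma tilt_const_near : exists p0 : R, tilt f c x = p0%:E /\
  \forall y \near x, M y -> tilt f c y = p0%:E.
Proof.
have [[[pf _ _] _ Mx] [_ [g gC2 hg]] hT [_ hisc]] := hps.
have gc : {for x, continuous g}.
  by apply: differentiable_continuous; have [] := nbhs_singleton gC2.
have fx : f x = (g x)%:E by exact: (nbhs_singleton hg).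
exists (g x + dot x c); split; first by rewrite /tilt fx.
have N1 := locally_polyhedral_double gc fx hg.
suff N2 : \forall y \near x, M y -> g y - g x = - dot c (y - x).
  apply: filterS2 hg N2 => y h1 h2 My; rewrite /tilt h1// -EFinD; congr (_%:E).
  by have := h2 My; rewrite dotBr !(dotC c); lra.
case: hnd => [[_ [e e0 he]]|hM].
  have V : nbhs (- c) (fun g' => norm2 (g' - - c) < e / 2).
    by apply: near_norm2_lt; rewrite divr_gt0.
  have := hisc _ hc _ V; move: N1 hg; apply: filterS3 => y h1 h2 h3 My.
  have [g' hg' ng'] := h3 My.
  have [E Sg'] := PSF_subdiff_eq fx (h2 My) (h1 My) hg'.
  (* 2 g' + c is the reflection of -c through g', within e of -c. Its subgradient inequality is the
     reverse of that of -c. *)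
  have S2 : subdiff f x (2 *: g' + c).
    apply: he; last first.
      have -> : 2 *: g' + c - - c = 2 *: (g' - - c).
        by apply/matrixP => i j; rewrite !mxE; ring.
      by rewrite norm2Z ger0_norm// mulrC -ltr_pdivlMr.
    exists 2%N, (fun i => if i == ord0 then 2 else -1),
      (fun i => if i == ord0 then g' else - c); split.
    - by move=> i; case: ifP.
    - by rewrite big_ord_recl big_ord1/=; ring.
    - by rewrite big_ord_recl big_ord1/= scaleN1r opprK.
  have := subdiff_le S2 fx (h2 My); have := subdiff_le hc fx (h2 My).
  by rewrite dotDl dotZl E dotNl; lra.
have := hisc _ hc setT (@filterT _ _ (nbhs_filter (- c))).
move: N1 hg; apply: filterS3 => y h1 h2 h3 My.
have [g' hg' _] := h3 My.
have [E Sg'] := PSF_subdiff_eq fx (h2 My) (h1 My) hg'.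
(* In the affine case y - x is tangent, hence orthogonal to g' + c, a difference of two subgradients
   at x. *)
have : psT f x (y - x) by rewrite -hT; exact: affine_tangent.
move=> /(_ (g' - - c)); rewrite dotC dotBl dotNl E => h.
have := h _; rewrite opprK => h'; apply/subr0_eq; rewrite h'//.
by exists g', (- c); rewrite opprK; split=> //; exact: aff_hull_mem.
Qed.

(* A constraint active at (x, f x) stays satisfied along a curve of M through
   x on which the tilted function is constant, so its derivative vanishes. *)
Lemma tilt_const_tangent h (p0 : R) : tilt f c x = p0%:E ->
  (\forall y \near x, M y -> tilt f c y = p0%:E) -> tangent_space M x h ->
  \forall t \near (0 : R), tilt f c (x + t *: h) = p0%:E.
Proof.
move=> tx tM [ga [ga0 gaM dga]]; have [q [k [A [a [b hq]]]] fq] := hpoly.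
pose f0 := p0 - dot x c.
have fE y : tilt f c y = p0%:E -> f y = (p0 - dot y c)%:E.
  rewrite /tilt; case: (f y) => [r| |]//; rewrite -EFinD => -[<-].
  by rewrite addrK.
have fx : f x = f0%:E by exact: fE.
pose u i := A^T *m delta_mx i ord0 : 'cV[R]_n.
have uE i z : (A *m z) i ord0 = dot z (u i) by rewrite dot_mulmxr trmxK dot_delta.
pose sg i := b i ord0 - (dot x (u i) + a i ord0 * f0).
have sg0 i : 0 <= sg i.
  rewrite subr_ge0 -uE; apply: (hq x f0).1.
  by rewrite -(nbhs_singleton fq) fx.
pose w i := u i - a i ord0 *: c.
have gac : {for (0 : R), continuous ga}.
  by apply: differentiable_continuous; apply/derivable1_diffP; exact: ex_derive.
have active i : sg i = 0 -> dot h (w i) = 0.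
  move=> si; have Nga : \forall t \near (0 : R), dot (ga t - x) (w i) <= 0.
    have T1 : \forall t \near (0 : R), M (ga t) -> tilt f c (ga t) = p0%:E.
      by apply: (gac (fun y => M y -> tilt f c y = p0%:E)); rewrite ga0.
    have T2 : \forall t \near (0 : R), f (ga t) = q (ga t).
      by apply: (gac (fun y => f y = q y)); rewrite ga0.
    move: T1 T2 gaM; apply: filterS3 => t h1 h2 h3.
    have fga := fE _ (h1 h3).
    have := (hq (ga t) (p0 - dot (ga t) c)).1; rewrite -h2 fga lexx => /(_ isT i).
    rewrite uE; move: si; rewrite /sg /w /f0 dotBr !dotBl !dotZr; lra.
  pose C := \sum_j `|w i j ord0| + 1.
  have C0 : 0 < C by rewrite ltr_wpDl// sumr_ge0.
  (* Following the curve in both directions, s = 1 and s = -1, bounds the derivative by 0 from both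
     sides. *)
  have key (s : R) : `|s| = 1 -> s * dot h (w i) <= 0.
    move=> s1; apply/ler_addgt0Pr => e e0; rewrite add0r.
    have eC : 0 < e / C by rewrite divr_gt0.
    have [d d0 hd] := is_derive_expansion dga eC.
    have /nbhs_ballP[r /= r0 hr] := Nga.
    pose t := Num.min r d / 2.
    have m0 : 0 < Num.min r d by rewrite lt_min r0.
    have t0 : 0 < t by rewrite divr_gt0.
    have tm : t < Num.min r d by rewrite /t; lra.
    have tr : t < r by rewrite (lt_le_trans tm)// ge_min lexx.
    have td : t < d by rewrite (lt_le_trans tm)// ge_min lexx orbT.
    have st : `|s * t| = t by rewrite normrM s1 mul1r ger0_norm// ltW.
    have h1 : dot (ga (s * t) - x) (w i) <= 0.
      by apply: hr; rewrite -ball_normE /= sub0r normrN st.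
    have := hd (s * t); rewrite st ga0 => /(_ td) h2.
    have := dot_le_mx_norm (ga (s * t) - x - (s * t) *: h) (w i).
    rewrite dotBl dotZl ler_norml => /andP[h3 _].
    have h4 : (\sum_j `|w i j ord0|) * `|ga (s * t) - x - (s * t) *: h| <= e * t.
      apply: (@le_trans _ _ (C * (e / C * t))).
        by apply: ler_pM => //; [exact: sumr_ge0|rewrite lerDl].
      by rewrite mulrA [C * _]mulrC divfK// lt0r_neq0.
    rewrite -(ler_pM2l t0); lra.
  have := key 1 (normr1 _); have := key (-1); rewrite normrN1 => /(_ erefl).
  by rewrite mulN1r mul1r => k1 k2; apply/eqP; rewrite eq_le k2 -oppr_le0 k1.
have N1 : \forall t \near (0 : R), forall i, t * dot h (w i) <= sg i.
  apply: (@filter_forall _ 'I_k (fun i t => t * dot h (w i) <= sg i)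
    (nbhs (0 : R))) => i.
  have [si|] := ltP 0 (sg i); last first.
    move=> si; have si0 : sg i = 0 by apply/eqP; rewrite eq_le si sg0.
    by apply: (@filterE R (nbhs (0 : R))) => t; rewrite active// si0 mulr0.
  pose C := `|dot h (w i)| + 1; have C0 : 0 < C by rewrite ltr_wpDl.
  apply/nbhs_ballP; exists (sg i / C); first by rewrite /= divr_gt0.
  move=> t; rewrite -ball_normE /= sub0r normrN ltr_pdivlMr// => /ltW ht.
  apply: le_trans ht; rewrite (le_trans (ler_norm _))// normrM ler_wpM2l//.
  by rewrite lerDl.
have [d d0 hd] := near_line h fq.
have N2 : \forall t \near (0 : R), f (x + t *: h) = q (x + t *: h).
  apply/nbhs_ballP; exists d => // t; rewrite -ball_normE /= sub0r normrN.
  exact: hd.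
move: N1 N2; apply: filterS2 => t h1 h2.
have hle : (f (x + t *: h) <= (p0 - dot (x + t *: h) c)%:E)%E.
  rewrite h2; apply/hq => i; rewrite uE; have := h1 i.
  by rewrite /sg /w /f0 dotBr dotZr !dotDl !dotZl; lra.
have := hc (x + t *: h); rewrite fx -EFinD [x + _ - x]addrAC subrr add0r => hge.
have E : f (x + t *: h) = (p0 - dot (x + t *: h) c)%:E.
  apply: le_anti; rewrite hle/=; apply: le_trans hge.
  by rewrite lee_fin /f0 dotNl dotDl dotZl dotZr (dotC c h); lra.
by rewrite /tilt E -EFinD subrK.
Qed.

Lemma second_derivative_const (phi : R -> R) (a p0 : R) :
  has_second_derivative phi 0 a -> (\forall t \near (0 : R), phi t = p0) -> a = 0.
Proof.
move=> [_ da] hphi; rewrite -[a](derive_val (is_derive := da)).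
have -> : 'D_1 (derive1 phi) 0 = 'D_1 (cst 0) (0 : R).
  apply: near_eq_derive; move: hphi => /nbhs_ballP[r /= r0 hr].
  apply/nbhs_ballP; exists r => // s bs; rewrite /= derive1E.
  rewrite (@near_eq_derive _ _ _ phi (cst p0)) ?derive_cst//.
  have : nbhs s (ball (0 : R) r) by apply: open_nbhs_nbhs; split=> //; exact: ball_open.
  by apply: filterS => t /hr.
exact: derive_cst.
Qed.

(** Each function whose second derivative defines the Hessian is constant near 0, so the quadratic
    form vanishes on the tangent space. *)
Lemma riem_hess_polyhedral :
  oproj (psT f x) *m riem_hess M (tilt f c) x *m oproj (psT f x) = 0.
Proof.
have [[_ _ Mx] _ hT _] := hps.
rewrite -hT /riem_hess; case: xgetP => [H _ [sH HT HO H2]|_]; last first.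
  by rewrite mulmx0 mul0mx.
have [p0 [tx tM]] := tilt_const_near.
have [e e0 he] := near_of_entries tM.
have Hq h : tangent_space M x h -> dot (H *m h) h = 0.
  move=> Th; apply: (second_derivative_const (H2 h Th) (p0 := p0)).
  have N1 := tilt_const_tangent tx tM Th.
  pose C := 2 * norm2 h + 1; have C0 : 0 < C.
    by rewrite ltr_wpDl// mulr_ge0// norm2_ge0.
  have N2 : \forall t \near (0 : R), `|t| * C < e.
    apply/nbhs_ballP; exists (e / C); first by rewrite /= divr_gt0.
    by move=> t; rewrite -ball_normE /= sub0r normrN ltr_pdivlMr.
  move: N1 N2; apply: filterS2 => t h1 h2.
  suff -> : tilt f c (nearest M (x + t *: h)) = p0%:E by [].
  (* If a nearest point exists it lies in M within 2 |t| |h| of x, where the tilt is constant.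
     Otherwise [nearest] returns x + t h itself, and constancy along the tangent line ([h1])
     applies. *)
  rewrite /nearest; case: xgetP => [y _ [My hy]|_] //.
  apply: he => // i; apply: le_lt_trans h2.
  have := hy x Mx; rewrite [x + _ - x]addrAC subrr add0r norm2Z => hn.
  have E : (y - x) i ord0 = t * h i ord0 - (x + t *: h - y) i ord0.
    by rewrite !mxE; ring.
  rewrite E (le_trans (ler_normB _ _))//.
  have := entry_le_norm2 (x + t *: h - y) i; have := entry_le_norm2 h i.
  rewrite normrM => h3 h4; have := ler_wpM2l (normr_ge0 t) h3.
  have := normr_ge0 t; rewrite /C; lra.
rewrite /oproj; case: xgetP => [P _ hP|_]; last by rewrite mulmx0.
have [sP _] := is_orth_proj_projector hP.
(* Polarization: the form vanishes at P z, P y and their sum, hence so does the bilinear form. *)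
apply: dot_mulmx_inj => z y; rewrite mul0mx dot0r -!mulmxA dot_mulmxr sP.
have Tz := (hP z).1; have Ty := (hP y).1.
have Tzy : tangent_space M x (P *m z + P *m y).
  by move: Tz Ty; rewrite hT => Tz Ty d hd; rewrite dotDl Tz// Ty// addr0.
have := Hq _ Tzy; rewrite mulmxDr dotDl !dotDr (Hq _ Tz) (Hq _ Ty).
by rewrite (dotC (H *m (P *m y))) (dot_symC _ _ sH) (dotC (H *m (P *m z))); lra.
Qed.

End LocallyPolyhedral.

(** * From the primal-dual setting to the matrix statements *)

Section Assembly.
Context (R : realType).

Lemma PSF_riem_hess_psd n (f : 'cV[R]_n -> \bar R) x c M :
  PSF f x M -> subdiff f x (- c) ->
  sym_psd (oproj (psT f x) *m riem_hess M (tilt f c) x *m oproj (psT f x)).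
Proof.
move=> [[[pf _ _] _ Mx] _ <- _] hc.
by have [fin_f min_f] := tilt_min pf hc; exact: riem_hess_psd.
Qed.

Lemma projected_form_le n (P H : 'M[R]_n) b : orth_projector P -> 0 <= b ->
  (forall h, dot h (H *m h) <= b * dot h h) ->
  forall h, dot h (P *m H *m P *m h) <= b * dot h h.
Proof.
move=> oP b0 hH h; rewrite -!mulmxA dot_mulmxr oP.1 (le_trans (hH _))//.
rewrite ler_wpM2l// -!sqr_norm2 lerXn2r ?nnegrE ?norm2_ge0//.
exact: norm2_projector_le.
Qed.

Lemma norm2_projected_le m n (P : 'M[R]_m) (A : 'M[R]_(m, n)) (Q : 'M[R]_n) x :
  orth_projector P -> orth_projector Q ->
  norm2 (P *m A *m Q *m x) <= opnorm A * norm2 x.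
Proof.
move=> oP oQ; rewrite -!mulmxA (le_trans (norm2_projector_le _ oP))//.
rewrite (le_trans (norm2_mulmx_le _ _))// ler_wpM2l ?opnorm_ge0//.
exact: norm2_projector_le.
Qed.

Lemma hess_cst n (a : R) (x : 'cV[R]_n) : hess (cst a) x = 0.
Proof.
apply/matrixP => i j; rewrite !mxE.
have -> : (fun y => grad (cst a) y i ord0) = cst 0.
  by apply/funext => y; rewrite mxE derive_cst.
by rewrite derive_cst.
Qed.

End Assembly.

Theorem lemma3p8 (R : realType) (n m : nat)
  (Rf : 'cV[R]_n -> \bar R) (F : 'cV[R]_n -> R)
  (J G : 'cV[R]_m -> \bar R) (L : 'M[R]_(m, n))
  (bF bG gR gJ : R) (xs : 'cV[R]_n) (vs : 'cV[R]_m)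
  (MR : set 'cV[R]_n) (MJ : set 'cV[R]_m)
  (hR : Gamma0 Rf) (hF : Gamma0 (fun x => (F x)%:E))
  (hJ : Gamma0 J) (hG : Gamma0 G)
  (hbF : 0 < bF) (hbG : 0 < bG) (hgR : 0 < gR) (hgJ : 0 < gJ)
  (hFdiff : forall x, differentiable F x)
  (hFlip : forall x y, norm2 (grad F x - grad F y) <= bF^-1 * norm2 (x - y))
  (hGstrong : strongly_convex bG G)
  (hKTx : [set g + L^T *m vs + grad F xs | g in subdiff Rf xs] 0)
  (hKTv : [set g - L *m xs + grad_conj G vs
             | g in subdiff (conjugate J) vs] 0)
  (hPSR : PSF Rf xs MR) (hPSJ : PSF (conjugate J) vs MJ)
  (hFC2 : C2_near F xs) (hGC2 : C2_near_ereal (conjugate G) vs)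
  (hND : (rel_int (subdiff Rf xs) (- (L^T *m vs) - grad F xs) /\
          rel_int (subdiff (conjugate J) vs) (L *m xs - grad_conj G vs)) \/
         (is_affine MR /\ is_affine MJ))
  (hdim : (set_dim (psT Rf xs) <= set_dim (psT (conjugate J) vs))%N) :
  let PR := oproj (psT Rf xs) in
  let PJ := oproj (psT (conjugate J) vs) in
  let HR := gR *: (PR *m riem_hess MR (Rbar Rf F L xs vs) xs *m PR) in
  let HJ := gJ *: (PJ *m riem_hess MJ (Jbar J G L xs vs) vs *m PJ) in
  let WR := invmx (1%:M + HR) in
  let WJ := invmx (1%:M + HJ) in
  let HF := PR *m hess F xs *m PR in
  let HG := PJ *m hess_conj G vs *m PJ in
  let Lb := PJ *m L *m PR in
  let l := \rank Lb in
  let M := fun theta : R => MPD gR gJ theta WR HF WJ HG Lb in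
  (* (i) *)
  (2 * Num.min bF bG * Num.min gJ^-1 gR^-1
       * (1 - Num.sqrt (gJ * gR * opnorm L ^+ 2)) > 1 ->
   forall theta : R, theta = 1 ->
   exists Minf : 'M[R]_(n + m),
     [/\ (fun k : nat => M theta ^+ k) @ \oo --> Minf,
         is_orth_proj Minf [set z | M theta *m z = z],
         forall k : nat, (0 < k)%N ->
           M theta ^+ k - Minf = (M theta - Minf) ^+ k,
         spectral_radius (M theta - Minf) < 1
       & forall rho : R, spectral_radius (M theta - Minf) < rho -> rho < 1 ->
           exists (K : nat) (C : R), forall k : nat, (K <= k)%N ->
             opnorm (M theta ^+ k - Minf) <= C * rho ^+ k])
  /\
  (* (ii) *)
  (gJ * gR * opnorm L ^+ 2 < 1 ->
   (forall x, F x = 0) -> (forall v, conjugate G v = 0%E) ->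
   locally_polyhedral Rf xs -> locally_polyhedral (conjugate J) vs ->
   forall theta : R, 0 < theta -> theta <= 1 ->
   exists Minf : 'M[R]_(n + m),
     [/\ (fun k : nat => M theta ^+ k) @ \oo --> Minf,
         forall (X : 'M[R]_m) (S : 'M[R]_(m, n)) (Y : 'M[R]_n),
           is_svd Lb X S Y ->
           Minf = block_mx Y 0 0 X
                  *m block_mx (copid_mx l) 0 0 (copid_mx l)
                  *m block_mx Y^T 0 0 X^T,
         forall z : R[i], cspectrum (M theta - Minf) z ->
           complex.Im z != 0 \/ (z = 0 /\ (l + l < n + m)%N),
         (0 < l)%N ->
           spectral_radius (M theta - Minf)
             = Num.sqrt (1 - theta * gR * gJ * sigma_min Lb ^+ 2)
       & spectral_radius (M theta - Minf) < 1]).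
Proof.
move=> PR PJ HR HJ WR WJ HF HG Lb l M.
pose cR := L^T *m vs + grad F xs; pose cJ := - (L *m xs - grad_conj G vs).
have hcR : subdiff Rf xs (- cR).
  have [g hg /eqP] := hKTx; rewrite -addrA addr_eq0 => /eqP gE.
  by rewrite /cR -gE.
have hcJ : subdiff (conjugate J) vs (- cJ).
  have [g hg /eqP] := hKTv; rewrite -addrA addr_eq0 opprD opprK => /eqP gE.
  by rewrite /cJ opprK -gE.
have RbarE : Rbar Rf F L xs vs = tilt Rf cR by [].
have JbarE : Jbar J G L xs vs = tilt (conjugate J) cJ.
  by apply/funext => y; rewrite /Jbar /tilt /cJ dotNr EFinN.
have oR : orth_projector PR by exact: oproj_projector.
have oJ : orth_projector PJ by exact: oproj_projector.
(* Projections do not increase norms, so the step size conditions on L pass to [Lb] with the same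
   constant. *)
have hLb x : norm2 (Lb *m x) <= opnorm L * norm2 x by exact: norm2_projected_le.
have l0 := opnorm_ge0 L.
split.
  move=> hstep theta th1; apply: (@MPD1_convergent R n m gR gJ theta HR HF HJ HG Lb bF bG (opnorm L)) => //.
  - apply: sym_psdZ; first exact: ltW.
    by rewrite RbarE; exact: PSF_riem_hess_psd.
  - apply: sym_psdZ; first exact: ltW.
    by rewrite JbarE; exact: PSF_riem_hess_psd.
  - by apply: sym_psd_proj; [exact: oR.1|apply: hess_convex_sym_psd => //; case: hF].
  - by apply: sym_psd_proj; [exact: oJ.1|exact: hess_conj_sym_psd].
  - apply: projected_form_le => //; first by rewrite invr_ge0 ltW.
    exact: hess_lipschitz_le.
  - apply: projected_form_le => //; first by rewrite invr_ge0 ltW.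
    exact: hess_conj_le.
move=> hstep F0 G0 polR polJ theta th0 th1.
have HR0 : HR = 0.
  rewrite /HR RbarE riem_hess_polyhedral ?scaler0//.
  case: hND => [[h _]|[h _]]; [left|by right].
  by rewrite /cR opprD.
have HJ0 : HJ = 0.
  rewrite /HJ JbarE riem_hess_polyhedral ?scaler0//.
  case: hND => [[_ h]|[_ h]]; [left|by right].
  by rewrite /cJ opprK.
have HF0 : HF = 0.
  have FE : F = cst 0 by apply/funext.
  by rewrite /HF FE hess_cst mulmx0 mul0mx.
have HG0 : HG = 0.
  have GE : fine \o conjugate G = cst 0 by apply/funext => v; rewrite /= G0.
  by rewrite /HG /hess_conj GE hess_cst mulmx0 mul0mx.
have WRE : WR = invmx (1%:M + 0) by rewrite /WR HR0.
have WJE : WJ = invmx (1%:M + 0) by rewrite /WJ HJ0.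
have -> : M theta = MPD gR gJ theta (invmx (1%:M + 0)) 0 (invmx (1%:M + 0)) 0 Lb.
  by rewrite /M WRE WJE HF0 HG0.
exact: (@polyhedral_convergent R n m gR gJ theta Lb (opnorm L)).
Qed.
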